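(* Let $m\le n$, let $\mathcal{A}:\mathbb{R}^{m\times n}\to\mathbb{R}^{d}$ be a linear map and let $b\in\mathbb{R}^d$. Let $\alpha\in[0,1/2]$ and $\epsilon\in(0,1/3]$. Let $X^{\ast}$ be a minimizer of the problem (TLAMRM) $\min_{X\in\mathbb{R}^{m\times n}} TL_{\alpha}^{\epsilon}(X)$ s.t. $\mathcal{A}(X)=b$, let $X_{0}$ be a minimizer of the problem (AMRM) $\min_{X\in\mathbb{R}^{m\times n}}\mathrm{rank}(X)$ s.t. $\mathcal{A}(X)=b$, and put $\beta=\mathrm{rank}(X_{0})$. If there is an integer $k>2\beta$ such that $$\epsilon^{1-2\alpha}(2\beta)^{-3/2}\sqrt{1-\delta_{2\beta+k}(\mathcal{A})}-\sqrt{\frac{1+\delta_{k}(\mathcal{A})}{k}}>0,$$ then the unique minimizer $X^{\ast}$ of (TLAMRM) is exactly $X_{0}$ (that is, the minimizer of (TLAMRM) is unique and $X^{\ast}=X_{0}$).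
   Context: For $X\in\mathbb{R}^{m\times n}$ with $m\le n$, $\sigma_1(X)\ge\cdots\ge\sigma_m(X)\ge 0$ denote the singular values of $X$ in descending order, and $$TL_{\alpha}^{\epsilon}(X)=\sum_{i=1}^{m}\frac{(\sigma_{i}(X))^{1/2}}{(\sigma_{i}(X)+\epsilon)^{1/2-\alpha}}.$$ For an integer $r$ with $1\le r\le m$, the restricted isometry constant $\delta_r(\mathcal{A})$ is the minimum constant such that $$(1-\delta_{r}(\mathcal{A}))\|X\|_{F}^{2}\leq\|\mathcal{A}(X)\|_{2}^{2}\leq(1+\delta_{r}(\mathcal{A}))\|X\|_{F}^{2}$$ for all $X\in\mathbb{R}^{m\times n}$ with $\mathrm{rank}(X)\le r$. Here $\|\cdot\|_F$ is the Frobenius norm and $\|\cdot\|_2$ the Euclidean norm. The displayed condition in the theorem is understood to presuppose that all quantities in it are defined. *)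

(* Defs.v *)
From mathcomp Require Import all_boot all_order all_algebra.
From mathcomp Require Import all_classical all_reals all_analysis.
From mathcomp Require Import polyrcf.

Set Implicit Arguments.
Unset Strict Implicit.
Unset Printing Implicit Defensive.

Import Order.TTheory GRing.Theory Num.Theory.
Local Open Scope classical_set_scope.
Local Open Scope ring_scope.

(* The eigenvalues in R of a square matrix, listed with algebraic
   multiplicity. *)
Definition eigenvalues (R : realType) (m : nat) (B : 'M[R]_m) : seq R :=
  flatten [seq nseq (mup x (char_poly B)) x | x <- rootsR (char_poly B)].

(* The singular values of an m x n matrix X with m <= n: the square roots of
   the m eigenvalues of X X^T, in descending order. *)
Definition singular_values (R : realType) (m n : nat) (X : 'M[R]_(m, n)) :
    seq R :=
  sort >=%R [seq Num.sqrt x | x <- eigenvalues (X *m X^T)].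

(* Indices start at 0: sigma X i is the (i+1)-th largest singular value. *)
Definition sigma (R : realType) (m n : nat) (X : 'M[R]_(m, n)) (i : 'I_m) : R :=
  (singular_values X)`_i.

Definition TL (R : realType) (m n : nat) (alpha epsilon : R)
    (X : 'M[R]_(m, n)) : R :=
  \sum_(i < m) (sigma X i `^ (1 / 2))
                 / ((sigma X i + epsilon) `^ (1 / 2 - alpha)).

(* The norm that the library puts on matrices is the maximum norm, hence the
   next two definitions. *)
Definition frobenius_norm (R : realType) (m n : nat) (X : 'M[R]_(m, n)) : R :=
  Num.sqrt (\sum_(i < m) \sum_(j < n) X i j ^+ 2).

Definition euclidean_norm (R : realType) (d : nat) (v : 'cV[R]_d) : R :=
  Num.sqrt (\sum_(i < d) v i 0 ^+ 2).

Definition restricted_isometry (R : realType) (m n d : nat)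
    (A : {linear 'M[R]_(m, n) -> 'cV[R]_d}) (r : nat) (delta : R) : Prop :=
  forall X : 'M[R]_(m, n), (\rank X <= r)%N ->
    (1 - delta) * frobenius_norm X ^+ 2 <= euclidean_norm (A X) ^+ 2 /\
    euclidean_norm (A X) ^+ 2 <= (1 + delta) * frobenius_norm X ^+ 2.

(* The minimum exists, so that the default value 0 is not used, whenever
   1 <= r and there is a nonzero m x n matrix. *)
Definition ric (R : realType) (m n d : nat)
    (A : {linear 'M[R]_(m, n) -> 'cV[R]_d}) (r : nat) : R :=
  xget 0 [set delta | restricted_isometry A r delta /\
    forall delta', restricted_isometry A r delta' -> delta <= delta'].

Definition is_minimizer (T : Type) (disp : Order.disp_t) (O : porderType disp)
    (f : T -> O) (C : set T) (x : T) : Prop :=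
  C x /\ forall y, C y -> (f x <= f y)%O.

(* Main.v *)
Require Import Defs.
From mathcomp Require Import all_boot all_order all_algebra.
From mathcomp Require Import all_classical all_reals all_analysis.
From mathcomp Require Import polyrcf complex spectral sesquilinear ring lra.

(* Let [f t = t^(1/2) / (t + epsilon)^(1/2 - alpha)], which is concave and
   nondecreasing with [f 0 = 0], so that [TL X] is the sum of [f] over the
   singular values of [X]. For such [f] this sum is subadditive (Rotfel'd): up to
   finitely many points [f] is a nonnegative combination of functions [min(., t)],
   and [sum_i min(sigma_i, t)] is the infimum of [nuclear Y + t * rank Z] over
   [X = Y + Z].

   Let [A X = A X0] and [TL X <= TL X0]. Split [X - X0 = D0 + Dc] with
   [rank D0 <= 2 beta] and with the row and column spaces of [Dc] orthogonal to
   those of [X0]. Then [TL X0 + TL Dc = TL (X - D0) <= TL X0 + TL D0], that is,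
   [TL Dc <= TL D0 <= 2 beta f(rho)] where [rho] is the Frobenius norm of [D0].
   Let [T] carry the [k] largest singular values of [Dc]. As [f] is nondecreasing,
   [f(t) / t] is nonincreasing and [k > 2 beta], the rest of [Dc], cut into blocks
   of rank [k], has an image of norm at most [sqrt ((1 + delta_k) / k) 2 beta rho],
   while this image is [- A (D0 + T)], of norm at least
   [sqrt (1 - delta_(2 beta + k)) rho]. Hence [rho = 0], and [X = X0]. *)

Import Order.TTheory GRing.Theory Num.Theory.
Local Open Scope classical_set_scope.
Local Open Scope ring_scope.

Set Implicit Arguments.
Unset Strict Implicit.

(** * Spectral theorem for real symmetric matrices *)

Lemma mxtrace_mul_tr (R : comPzRingType) (m n : nat) (X Y : 'M[R]_(m, n)) :
  \tr (X *m Y^T) = \sum_i \sum_j X i j * Y i j.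
Proof.
rewrite /mxtrace; apply: eq_bigr => i _; rewrite mxE.
by apply: eq_bigr => j _; rewrite mxE.
Qed.

Lemma mxtrace_gram_ge0 (R : realDomainType) (m n : nat) (X : 'M[R]_(m, n)) :
  0 <= \tr (X *m X^T).
Proof.
rewrite mxtrace_mul_tr; do 2 (apply: sumr_ge0 => ? _).
by rewrite -expr2 sqr_ge0.
Qed.

Lemma mxtrace_gram_eq0 (R : realDomainType) (m n : nat) (X : 'M[R]_(m, n)) :
  \tr (X *m X^T) = 0 -> X = 0.
Proof.
rewrite mxtrace_mul_tr => /psumr_eq0P X0; apply/matrixP => i j; rewrite mxE.
have /psumr_eq0P Xi : \sum_j X i j * X i j = 0.
  by apply: X0 => // k _; apply: sumr_ge0 => l _; rewrite -expr2 sqr_ge0.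
have /Xi/(_ j isT)/eqP : forall k, true -> 0 <= X i k * X i k.
  by move=> k _; rewrite -expr2 sqr_ge0.
by rewrite -expr2 sqrf_eq0 => /eqP.
Qed.

Lemma gram_eq0 (R : realDomainType) (m n : nat) (X : 'M[R]_(m, n)) :
  X *m X^T = 0 -> X = 0.
Proof. by move=> X0; apply: mxtrace_gram_eq0; rewrite X0 mxtrace0. Qed.

(** Over [R[i]] the matrix is Hermitian, so its spectrum is real. An eigenvalue is a root of the
    real characteristic polynomial, hence it has an eigenvector with entries in [R]. *)
Lemma symmetric_eigenvector (R : rcfType) (n : nat) (B : 'M[R]_n.+1) :
  B^T = B -> exists a (v : 'rV_n.+1), v != 0 /\ v *m B = a *: v.
Proof.
move=> Bsym; pose BC := map_mx (real_complex R) B.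
have BCherm : BC \is hermsymmx.
  apply/realsym_hermsym.
    apply/is_hermitianmxP; rewrite expr0 scale1r.
    by apply/matrixP => i j; rewrite !mxE -[in LHS]Bsym mxE.
  by apply/mxOverP => i j; rewrite mxE /= complex_real.
have /orthomx_spectralP BCE := hermitian_normalmx BCherm.
set P := spectralmx BC in BCE; set D := spectral_diag BC in BCE.
have Dreal : D 0 0 \is Num.real by apply/mxOverP/hermitian_spectral_diag_real.
have Pu : P \in unitmx by rewrite spectral_unit.
have eigC : eigenvalue BC (D 0 0).
  apply/eigenvalueP; exists (row 0 P).
    rewrite BCE !mulmxA -!row_mul mulmxV // mul1mx.
    by rewrite row_mul row_diag_mx -scalemxAl -rowE.
  apply/negP => /eqP P0.
  have /row_freeP [Q PQ] : row_free P by rewrite row_free_unit.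
  have /matrixP/(_ 0 0) := congr1 (row 0) PQ.
  by rewrite row_mul P0 mul0mx !mxE eqxx => /eqP; rewrite eq_sym oner_eq0.
have [a aE] : exists a : R, D 0 0 = real_complex R a.
  by exists (complex.Re (D 0 0)); apply/esym/RRe_real.
have /eigenvalueP [v vB v0] : eigenvalue B a.
  move: eigC; rewrite !eigenvalue_root_char -map_char_poly aE.
  by rewrite fmorph_root.
by exists a, v.
Qed.

(** With [e] the first basis vector and [w = v - e] nonzero, [H] is the reflection in the hyperplane
    orthogonal to [w]. It sends [v] to [e] because both have norm 1, so that [2 <v, w> = <w, w>]. *)
Lemma householder (R : rcfType) (n : nat) (v : 'rV[R]_(1 + n)) :
  v *m v^T = 1%:M ->
  exists H : 'M[R]_(1 + n), [/\ H^T = H, H *m H = 1%:M & v *m H = row_mx 1%:M 0].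
Proof.
move=> v1; pose e : 'rV[R]_(1 + n) := row_mx 1%:M 0; pose w := v - e.
have e1 : e *m e^T = 1%:M.
  by rewrite /e tr_row_mx mul_row_col trmx1 trmx0 mulmx1 mulmx0 addr0.
have [w0|w0] := eqVneq w 0.
  exists 1%:M; split; rewrite ?trmx1 ?mulmx1 //.
  by apply/eqP; rewrite -subr_eq0; apply/eqP.
set c := (w *m w^T) 0 0.
have cE : w *m w^T = c%:M by rewrite [LHS]mx11_scalar.
have c0 : c != 0.
  apply: contra_neq w0 => c0; apply: gram_eq0.
  by rewrite cE c0 raddf0.
have ev : e *m v^T = v *m e^T.
  apply/matrixP => i j; rewrite !mxE !ord1; apply: eq_bigr => k _.
  by rewrite !mxE mulrC.
have vw : 2 *: (v *m w^T) = c%:M.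
  rewrite -cE /w [(v - e)^T]linearB /= !mulmxBl !mulmxBr v1 e1 ev.
  by move: (v *m e^T) => x; apply/matrixP => i j; rewrite !mxE; ring.
pose H := 1%:M - (2 / c) *: (w^T *m w).
exists H; split.
- by rewrite /H linearB /= linearZ /= trmx_mul trmxK trmx1.
- have GG : (w^T *m w) *m (w^T *m w) = c *: (w^T *m w).
    by rewrite mulmxA -[_ *m w *m w^T]mulmxA cE mul_mx_scalar scalemxAl.
  rewrite /H mulmxBr mulmx1 -scalemxAr mulmxBl mul1mx -scalemxAl.
  rewrite GG; move: (w^T *m w) => G; apply/matrixP => i j; rewrite !mxE.
  by field.
- rewrite /H mulmxBr mulmx1 -scalemxAr mulmxA mulrC -scalerA scalemxAl vw.
  by rewrite mul_scalar_mx scalerA mulVf // scale1r opprB addrCA subrr addr0.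
Qed.

(** Deflation: a reflection moves a unit eigenvector to the first basis vector; by symmetry the
    first row and the first column of the conjugated matrix split off together. *)
Lemma real_spectral (R : rcfType) (n : nat) (B : 'M[R]_n) : B^T = B ->
  exists (U : 'M[R]_n) (d : 'rV[R]_n),
    U *m U^T = 1%:M /\ B = U *m diag_mx d *m U^T.
Proof.
elim: n B => [|n IHn] B Bsym.
  by exists 1%:M, 0; split; apply/matrixP => -[].
have [a [v [v0 vB]]] := symmetric_eigenvector Bsym.
set c := (v *m v^T) 0 0.
have c_gt0 : 0 < c.
  have -> : c = \tr (v *m v^T) by rewrite /mxtrace big_ord1.
  rewrite lt_neqAle mxtrace_gram_ge0 andbT eq_sym.
  by apply: contra_neq v0 => /mxtrace_gram_eq0.
pose u : 'rV[R]_(1 + n) := (Num.sqrt c)^-1 *: v.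
have u1 : u *m u^T = 1%:M.
  rewrite /u linearZ /= -scalemxAl -scalemxAr [v *m _]mx11_scalar -/c.
  rewrite scalerA -expr2 exprVn sqr_sqrtr ?ltW //.
  by rewrite scale_scalar_mx mulVf // gt_eqF.
have uB : u *m B = a *: u by rewrite /u -scalemxAl vB !scalerA mulrC.
have [H [Hsym HH uH]] := householder u1.
set C : 'M[R]_(1 + n) := H *m B *m H.
have Csym : C^T = C by rewrite /C !trmx_mul Hsym Bsym mulmxA.
have eH : row_mx 1%:M 0 *m H = u by rewrite -uH -mulmxA HH mulmx1.
have eC : row_mx 1%:M 0 *m C = a *: (row_mx 1%:M 0 : 'rV[R]_(1 + n)).
  by rewrite /C !mulmxA eH uB -scalemxAl uH.
pose B' := drsubmx C.
have CE : C = block_mx a%:M 0 0 B'.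
  have ur : ulsubmx C = a%:M /\ ursubmx C = 0.
    move: eC; rewrite -{1}(submxK C) mul_row_block !mul1mx !mul0mx !addr0.
    by rewrite scale_row_mx scaler0 scalemx1 => /eq_row_mx.
  rewrite -{1}(submxK C); congr block_mx; try by case: ur.
  by rewrite -(trmxK (dlsubmx C)) trmx_dlsub Csym (proj2 ur) trmx0.
have B'sym : B'^T = B' by rewrite /B' trmx_drsub Csym.
have [U' [d' [U'U B'E]]] := IHn B' B'sym.
pose V : 'M[R]_(1 + n) := block_mx 1%:M 0 0 U'.
have VV : V *m V^T = 1%:M.
  rewrite /V tr_block_mx mulmx_block trmx1 !trmx0 !mulmx0 !mul0mx mulmx1 U'U.
  by rewrite !addr0 add0r scalar_mx_block.
have VD : V *m diag_mx (row_mx a%:M d' : 'rV[R]_(1 + n)) *m V^T = C.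
  have -> : diag_mx (row_mx a%:M d') = block_mx a%:M 0 0 (diag_mx d').
    rewrite diag_mx_row; congr block_mx.
    by apply/matrixP => i j; rewrite !ord1 !mxE.
  rewrite CE /V tr_block_mx !mulmx_block trmx1 !trmx0 !mulmx0 !mul0mx.
  by rewrite !addr0 !add0r ?mulmx0 ?mul0mx ?addr0 ?add0r !mul1mx !mulmx1 -B'E.
exists (H *m V), (row_mx a%:M d' : 'rV[R]_(1 + n)); split.
  by rewrite trmx_mul mulmxA -(mulmxA H) VV mulmx1 Hsym.
have -> : B = H *m C *m H.
  by rewrite /C !mulmxA HH mul1mx -mulmxA HH mulmx1.
by rewrite trmx_mul Hsym -VD !mulmxA.
Qed.

(** * Singular value decompositions *)

Lemma char_poly_conj_diag (R : comUnitRingType) (m : nat) (U : 'M[R]_m)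
    (d : 'rV[R]_m) :
  U *m U^T = 1%:M ->
  char_poly (U *m diag_mx d *m U^T) = \prod_i ('X - (d 0 i)%:P).
Proof.
move=> UU; pose P := map_mx polyC U.
have PP : P *m P^T = 1%:M.
  by rewrite /P map_trmx -map_mxM UU map_scalar_mx.
have -> : \prod_i ('X - (d 0 i)%:P) = char_poly (diag_mx d).
  rewrite char_poly_trig; first by apply: eq_bigr => i _; rewrite mxE eqxx.
  exact: (diag_mx_is_trig d).
rewrite /char_poly /char_poly_mx.
have -> : 'X%:M - map_mx polyC (U *m diag_mx d *m U^T) =
    P *m ('X%:M - map_mx polyC (diag_mx d)) *m P^T.
  rewrite mulmxBr mulmxBl mul_mx_scalar -scalemxAl PP scalemx1.
  by rewrite !map_mxM -map_trmx.
by rewrite !det_mulmx mulrAC -det_mulmx PP det1 mul1r.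
Qed.

(** The reason is [(x - M)(x - N) = x (x - (M + N))]. For Gram matrices this says that, up to zeros,
    the spectrum of the sum is the union of the spectra. *)
Lemma char_poly_add_orthogonal (R : comNzRingType) (m : nat) (M N : 'M[R]_m) :
  M *m N = 0 -> char_poly M * char_poly N = 'X ^+ m * char_poly (M + N).
Proof.
move=> MN; rewrite /char_poly -det_mulmx -det_scalar -det_mulmx; congr (\det _).
rewrite /char_poly_mx map_mxD mulmxBl !mulmxBr -map_mxM MN map_mx0 subr0.
by rewrite !mul_scalar_mx mul_mx_scalar scalerDr opprD addrA addrAC.
Qed.

(** The lists are compared by the number of occurrences of each [y], which on both sides is the
    multiplicity of [y] as a root. *)
Lemma eigenvalues_perm (R : realType) (m : nat) (B : 'M[R]_m) (s : seq R) :
  char_poly B = \prod_(x <- s) ('X - x%:P) -> perm_eq (eigenvalues B) s.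
Proof.
move=> pE; have p0 : char_poly B != 0 by rewrite monic_neq0 // char_poly_monic.
apply/allP => y _ /=; apply/eqP.
have -> : count_mem y s = mup y (char_poly B) by rewrite pE mu_prod_XsubC.
rewrite /eigenvalues.
rewrite count_flatten -map_comp sumnE big_map.
rewrite (eq_bigr (fun x => if x == y then mup y (char_poly B) else 0%N)); last first.
  move=> x _ /=; rewrite count_nseq /=.
  by have [->|_] := eqVneq x y; rewrite ?mul1n ?mul0n.
rewrite -big_mkcond /=.
have yroots : (y \in rootsR (char_poly B)) = root (char_poly B) y.
  by rewrite -roots_on_rootsR // in_itv.
case: (boolP (root (char_poly B) y)) => ry.
  rewrite -big_filter (_ : [seq i <- _ | _] = [:: y]) ?big_seq1 //.
  by rewrite filter_pred1_uniq ?uniq_roots // yroots.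
by rewrite mupNroot // big1_seq.
Qed.

Definition tl (R : realType) (alpha epsilon t : R) : R :=
  t `^ (1 / 2) / (t + epsilon) `^ (1 / 2 - alpha).

(** A sum does not depend on the order of its terms, so [TL] can be computed from any such family,
    without sorting. *)
Lemma TL_char_poly (R : realType) (m n : nat) (alpha epsilon : R)
    (X : 'M[R]_(m, n)) (s : 'I_m -> R) : (forall i, 0 <= s i) ->
  char_poly (X *m X^T) = \prod_i ('X - (s i ^+ 2)%:P) ->
  TL alpha epsilon X = \sum_i tl alpha epsilon (s i).
Proof.
move=> s0 pE; pose t := [seq s i | i <- enum 'I_m].
have sv : perm_eq (singular_values X) t.
  rewrite /singular_values perm_sort.
  have -> : t = [seq Num.sqrt x | x <- [seq s i ^+ 2 | i <- enum 'I_m]].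
    by rewrite -map_comp; apply: eq_map => i /=; rewrite sqrtr_sqr ger0_norm.
  by apply/perm_map/eigenvalues_perm; rewrite pE big_map big_enum.
have szt : size (singular_values X) = m.
  by rewrite (perm_size sv) size_map size_enum_ord.
have -> : \sum_i tl alpha epsilon (s i) = \sum_(x <- t) tl alpha epsilon x.
  by rewrite big_map big_enum.
rewrite -(perm_big _ sv) (big_nth 0) szt big_mkord.
by apply: eq_bigr.
Qed.

Lemma TL_spectral (R : realType) (m n : nat) (alpha epsilon : R)
    (X : 'M[R]_(m, n)) (U : 'M[R]_m) (s : 'rV[R]_m) : (forall i, 0 <= s 0 i) ->
  U *m U^T = 1%:M ->
  X *m X^T = U *m diag_mx (\row_i s 0 i ^+ 2) *m U^T ->
  TL alpha epsilon X = \sum_i tl alpha epsilon (s 0 i).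
Proof.
move=> s0 UU XE; apply: TL_char_poly => //; rewrite XE char_poly_conj_diag //.
by apply: eq_bigr => i _; rewrite mxE.
Qed.

(* Left vectors are completed to an orthonormal basis, whereas the right vector
   belonging to a zero singular value is 0. *)
Definition svd (R : realType) (m n : nat) (X : 'M[R]_(m, n))
    (U : 'M[R]_m) (s : 'rV[R]_m) (V : 'M[R]_(m, n)) :=
  [/\ forall i, 0 <= s 0 i, U *m U^T = 1%:M,
      V *m V^T = diag_mx (\row_i (s 0 i != 0)%:R) & X = U *m diag_mx s *m V].

Lemma gram_diag_ge0 (R : realDomainType) (m n : nat) (Y : 'M[R]_(m, n)) i :
  0 <= (Y *m Y^T) i i.
Proof. by rewrite mxE sumr_ge0 // => j _; rewrite mxE -expr2 sqr_ge0. Qed.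

Lemma gram_spectrum_ge0 (R : realType) (m n : nat) (X : 'M[R]_(m, n))
    (U : 'M[R]_m) (d : 'rV[R]_m) : U *m U^T = 1%:M ->
  X *m X^T = U *m diag_mx d *m U^T -> forall i, 0 <= d 0 i.
Proof.
move=> UU XE i; have UU' : U^T *m U = 1%:M by exact: mulmx1C.
have dE : (U^T *m X) *m (U^T *m X)^T = diag_mx d.
  rewrite trmx_mul trmxK -mulmxA (mulmxA X) XE !mulmxA UU' mul1mx.
  by rewrite -mulmxA UU' mulmx1.
have := gram_diag_ge0 (U^T *m X) i.
by rewrite dE mxE eqxx mulr1n.
Qed.

Lemma svd_exists (R : realType) (m n : nat) (X : 'M[R]_(m, n)) :
  exists U s V, svd X U s V.
Proof.
have Gsym : (X *m X^T)^T = X *m X^T by rewrite trmx_mul trmxK.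
have [U [d [UU XE]]] := real_spectral Gsym.
have d0 := gram_spectrum_ge0 UU XE.
have UU' : U^T *m U = 1%:M by exact: mulmx1C.
have dE : (U^T *m X) *m (U^T *m X)^T = diag_mx d.
  rewrite trmx_mul trmxK -mulmxA (mulmxA X) XE !mulmxA UU' mul1mx.
  by rewrite -mulmxA UU' mulmx1.
pose s : 'rV[R]_m := \row_i Num.sqrt (d 0 i).
(* The rows of [U^T *m X] are orthogonal with norms [s 0 i]. Since [0^-1 = 0], scaling by [r]
   normalizes the nonzero rows and leaves the others 0. *)
pose r : 'rV[R]_m := \row_i (s 0 i)^-1.
exists U, s, (diag_mx r *m (U^T *m X)); split => //.
- by move=> i; rewrite mxE sqrtr_ge0.
- rewrite trmx_mul tr_diag_mx -mulmxA (mulmxA _ _ (diag_mx r)) dE !mulmx_diag.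
  congr diag_mx; apply/rowP => i; rewrite !mxE.
  rewrite -[d 0 i in X in _ * (X * _)]sqr_sqrtr //.
  have [->|s0] := eqVneq (Num.sqrt (d 0 i)) 0; first by rewrite invr0 mul0r.
  by rewrite expr2 mulfK // mulVf.
(* The mask loses nothing: a row with [s 0 i = 0] has norm 0. *)
have projX : diag_mx (\row_i (s 0 i != 0)%:R) *m (U^T *m X) = U^T *m X.
  have Z0 : diag_mx (\row_i (s 0 i == 0)%:R) *m (U^T *m X) = 0.
    apply: gram_eq0; rewrite [(diag_mx _ *m _)^T]trmx_mul tr_diag_mx.
    rewrite -mulmxA (mulmxA _ _ (diag_mx _)) dE !mulmx_diag.
    apply/matrixP => i j; rewrite !mxE sqrtr_eq0.
    have [/(conj (d0 i))/andP/le_anti <-|_] := leP (d 0 i) 0.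
      by rewrite mul0r mulr0 mul0rn.
    by rewrite mul0r mul0rn.
  rewrite -[RHS]mul1mx -[RHS]subr0 -Z0 -mulmxBl; congr (_ *m _).
  apply/matrixP => i j; rewrite !mxE.
  case: (i == j); last by rewrite !mulr0n subr0.
  by case: (_ == 0); rewrite ?subrr ?subr0.
rewrite -mulmxA (mulmxA (diag_mx s)) mulmx_diag.
have -> : \row_i (s 0 i * r 0 i) = \row_i (s 0 i != 0)%:R.
  apply/rowP => i; rewrite [LHS]mxE [RHS]mxE [r 0 i]mxE.
  by have [->|s0] := eqVneq (s 0 i) 0; rewrite ?mul0r // mulfV.
by rewrite projX mulmxA UU mul1mx.
Qed.

(** * Subadditivity of truncated singular value sums *)

Lemma rank_diag_mx (F : fieldType) (m : nat) (d : 'rV[F]_m) :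
  \rank (diag_mx d) = #|[pred i | d 0 i != 0]|.
Proof.
pose S := (\sum_(i | d 0 i != 0) <<delta_mx 0 i : 'rV[F]_m>>)%MS.
have rS : \rank S = #|[pred i | d 0 i != 0]|.
  have /mxdirectP -> : mxdirect (\sum_(i | d 0 i != 0) <<delta_mx 0 i : 'rV[F]_m>>).
    exact: mxdirect_delta.
  rewrite /= -sum1_card; apply: eq_bigr => i _.
  by rewrite mxrank_gen mxrank_delta.
rewrite -rS; apply/eqmx_rank/andP; split.
  apply/row_subP => i; rewrite row_diag_mx.
  have [->|d0] := eqVneq (d 0 i) 0; first by rewrite scale0r sub0mx.
  by apply: scalemx_sub; apply: (sumsmx_sup i) => //; rewrite genmxE.
apply/sumsmx_subP => i d0; rewrite genmxE.
have -> : delta_mx 0 i = (d 0 i)^-1 *: row i (diag_mx d).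
  by rewrite row_diag_mx scalerA mulVf // scale1r.
exact/scalemx_sub/row_sub.
Qed.

Section SvdTheory.
Variables (R : realType) (m n : nat) (X : 'M[R]_(m, n)).
Variables (U : 'M[R]_m) (s : 'rV[R]_m) (V : 'M[R]_(m, n)).
Hypothesis XE : svd X U s V.

Lemma svd_ge0 i : 0 <= s 0 i. Proof. by case: XE. Qed.

Lemma svd_UUt : U *m U^T = 1%:M. Proof. by case: XE. Qed.

Lemma svd_UtU : U^T *m U = 1%:M. Proof. exact/mulmx1C/svd_UUt. Qed.

Lemma svdE : X = U *m diag_mx s *m V. Proof. by case: XE. Qed.

(** [V] is a partial isometry: [V *m V^T] is a projection, so [(1 - V V^T) V] has a zero Gram
    matrix. *)
Lemma svd_VVtV : V *m V^T *m V = V.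
Proof.
case: XE => _ _ VV _; set D := diag_mx _ in VV.
have DD : D *m D = D.
  rewrite mulmx_diag; congr diag_mx; apply/rowP => i; rewrite !mxE.
  by case: (_ == 0); rewrite ?mulr0 ?mulr1.
have Dsym : D^T = D by rewrite tr_diag_mx.
apply/esym/eqP; rewrite -subr_eq0 -{1}[V]mul1mx -mulmxBl VV; apply/eqP.
apply: gram_eq0; rewrite trmx_mul -mulmxA (mulmxA V) VV.
by rewrite linearB /= trmx1 Dsym mulmxBr mulmx1 DD subrr mulmx0.
Qed.

Lemma svd_mulVt : X *m V^T = U *m diag_mx s.
Proof.
case: XE => _ _ VV ->; rewrite -mulmxA VV -mulmxA mulmx_diag.
congr (_ *m diag_mx _); apply/rowP => i; rewrite !mxE.
by have [->|] := eqVneq (s 0 i) 0; rewrite ?mulr0 ?mulr1.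
Qed.

Lemma svd_mulUt : U^T *m X = diag_mx s *m V.
Proof. by rewrite svdE !mulmxA svd_UtU mul1mx. Qed.

Lemma svd_gram : X *m X^T = U *m diag_mx (\row_i s 0 i ^+ 2) *m U^T.
Proof.
rewrite {2}svdE !trmx_mul tr_diag_mx !mulmxA svd_mulVt.
by rewrite -(mulmxA U) mulmx_diag; congr (_ *m diag_mx _ *m _).
Qed.

Lemma svd_TL alpha epsilon : TL alpha epsilon X = \sum_i tl alpha epsilon (s 0 i).
Proof. exact: TL_spectral svd_ge0 svd_UUt svd_gram. Qed.

Lemma svd_mxtrace_gram : \tr (X *m X^T) = \sum_i s 0 i ^+ 2.
Proof.
rewrite svd_gram mxtrace_mulC mulmxA svd_UtU mul1mx mxtrace_diag.
by apply: eq_bigr => i _; rewrite mxE.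
Qed.

Lemma svd_rank : \rank X = #|[pred i | s 0 i != 0]|.
Proof.
rewrite -rank_diag_mx; apply/eqP; rewrite eqn_leq; apply/andP; split.
  by rewrite svdE -mulmxA; apply: leq_trans (mxrankM_maxr _ _) (mxrankM_maxl _ _).
have -> : diag_mx s = U^T *m (X *m V^T).
  by rewrite svd_mulVt mulmxA svd_UtU mul1mx.
exact: leq_trans (mxrankM_maxr _ _) (mxrankM_maxl _ _).
Qed.

Lemma svd_VVt_le1 i : (V *m V^T) i i <= 1.
Proof.
case: XE => _ _ -> _; rewrite !mxE eqxx mulr1n.
by case: (_ == 0); rewrite ?ler01.
Qed.

Lemma svd_opp : svd (- X) (- U) s V.
Proof.
case: XE => s0 UU VV ->; split => //; last by rewrite !mulNmx.
by rewrite linearN /= mulNmx mulmxN opprK.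
Qed.

End SvdTheory.

Definition orth_proj (R : pzRingType) (m : nat) (Q : 'M[R]_m) :=
  Q^T = Q /\ Q *m Q = Q.

Lemma orth_projC (R : pzRingType) (m : nat) (Q : 'M[R]_m) :
  orth_proj Q -> orth_proj (1%:M - Q).
Proof.
move=> [Qsym QQ]; split; first by rewrite linearB /= trmx1 Qsym.
by rewrite mulmxBr mulmx1 mulmxBl mul1mx QQ subrr subr0.
Qed.

Lemma orth_proj_quad_ge0 (R : realDomainType) (m n : nat) (Q : 'M[R]_n)
  (Y : 'M[R]_(m, n)) i : orth_proj Q -> 0 <= (Y *m Q *m Y^T) i i.
Proof.
move=> [Qsym QQ]; have -> : Y *m Q *m Y^T = (Y *m Q) *m (Y *m Q)^T.
  by rewrite trmx_mul Qsym [RHS]mulmxA -[Y *m Q *m Q]mulmxA QQ.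
exact: gram_diag_ge0.
Qed.

Lemma orth_proj_quad_le (R : realDomainType) (m n : nat) (Q : 'M[R]_n)
  (Y : 'M[R]_(m, n)) i : orth_proj Q -> (Y *m Q *m Y^T) i i <= (Y *m Y^T) i i.
Proof.
move=> /orth_projC/(orth_proj_quad_ge0 Y i).
rewrite mulmxBr mulmx1 mulmxBl.
by move: (Y *m Y^T) (Y *m Q *m Y^T) => S T; rewrite !mxE subr_ge0.
Qed.

(** The column space of [Z] is spanned by the left singular vectors with nonzero singular value; [Q]
    is the orthogonal projection onto it. *)
Lemma orth_proj_exists (R : realType) (m n : nat) (Z : 'M[R]_(m, n)) :
  exists Q, [/\ orth_proj Q, Q *m Z = Z, \tr Q = (\rank Z)%:R
    & (\rank Q <= \rank Z)%N].
Proof.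
have [U [s [V sZ]]] := svd_exists Z.
pose E : 'M[R]_m := diag_mx (\row_i (s 0 i != 0)%:R).
have EE : E *m E = E.
  rewrite mulmx_diag; congr diag_mx; apply/rowP => i; rewrite !mxE.
  by case: (_ == 0); rewrite ?mulr0 ?mulr1.
have Es : E *m diag_mx s = diag_mx s.
  rewrite mulmx_diag; congr diag_mx; apply/rowP => i; rewrite !mxE.
  by have [->|] := eqVneq (s 0 i) 0; rewrite ?mulr0 ?mul1r.
exists (U *m E *m U^T); split.
- split; first by rewrite !trmx_mul trmxK tr_diag_mx mulmxA.
  by rewrite !mulmxA -(mulmxA _ _ U) (svd_UtU sZ) mulmx1 -[U *m E *m E]mulmxA EE.
- by rewrite -!mulmxA (svd_mulUt sZ) (mulmxA E) Es mulmxA -(svdE sZ).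
- rewrite mxtrace_mulC mulmxA (svd_UtU sZ) mul1mx mxtrace_diag (svd_rank sZ).
  rewrite -sum1_card natr_sum [RHS]big_mkcond /=; apply: eq_bigr => i _.
  by rewrite mxE inE; case: eqP.
- rewrite (svd_rank sZ); apply: leq_trans (mxrankM_maxl _ _) _.
  apply: leq_trans (mxrankM_maxr _ _) _; rewrite rank_diag_mx.
  apply/subset_leq_card/fintype.subsetP => i; rewrite !inE mxE.
  by case: (s 0 i == 0); rewrite ?eqxx.
Qed.

(** The hypotheses bound the norms of a row of [G] and of a column of [F]; their inner product is
    estimated termwise by [x y <= (x^2 + y^2) / 2]. *)
Lemma mulmx_diag_le1 (R : realFieldType) (m n : nat) (G : 'M[R]_(m, n))
    (F : 'M[R]_(n, m)) i :
  (G *m G^T) i i <= 1 -> (F^T *m F) i i <= 1 -> (G *m F) i i <= 1.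
Proof.
move=> G1 F1; have : (G *m F) i i <= 2^-1 * ((G *m G^T) i i + (F^T *m F) i i).
  rewrite !mxE -big_split mulr_sumr; apply: ler_sum => j _ /=; rewrite !mxE.
  by have := sqr_ge0 (G i j - F j i); lra.
lra.
Qed.

Section MinSubadditive.
Variables (R : realType) (m n : nat).

(** This is the duality of nuclear and operator norm: by cyclicity the trace is a sum of [d 0 i]
    times the inner product of two vectors of norm at most 1, as [W] is a partial isometry and [Q] a
    projection. *)
Lemma mxtrace_dual_le (A : 'M[R]_(m, n)) UA a VA (d : 'rV[R]_m) (Q : 'M[R]_m)
  (W : 'M[R]_(m, n)) : svd A UA a VA -> (forall i, 0 <= d 0 i) ->
  orth_proj Q -> orth_proj (W^T *m W) ->
  \tr (Q *m (UA *m diag_mx d *m VA) *m W^T) <= \sum_i d 0 i.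
Proof.
move=> sA d0 pQ pW.
have -> : \tr (Q *m (UA *m diag_mx d *m VA) *m W^T) =
    \tr (diag_mx d *m (VA *m W^T *m (Q *m UA))).
  by rewrite [RHS]mxtrace_mulC -(mulmxA (VA *m W^T)) [RHS]mxtrace_mulC !mulmxA.
rewrite mul_diag_mx /mxtrace; apply: ler_sum => i _; rewrite mxE.
apply: ler_piMr => //; apply: mulmx_diag_le1.
  rewrite trmx_mul trmxK mulmxA -(mulmxA VA).
  exact: le_trans (orth_proj_quad_le _ _ pW) (svd_VVt_le1 sA i).
have := orth_proj_quad_le UA^T i pQ; case: pQ => Qsym QQ.
rewrite trmxK (svd_UtU sA) trmx_mul Qsym mulmxA -[UA^T *m Q *m Q]mulmxA QQ.
by move=> /le_trans; apply; rewrite !mxE eqxx.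
Qed.

(* This is the triangle inequality for the nuclear norm combined with
   subadditivity of the rank: [\sum_i min(s_i, t)] is the infimum of
   [nuclear Y + t * rank Z] over the decompositions [X = Y + Z]. *)
Lemma sum_min_svd_subadd (A B : 'M[R]_(m, n)) UA a VA UB b VB U s V (t : R) :
  svd A UA a VA -> svd B UB b VB -> svd (A + B) U s V -> 0 <= t ->
  \sum_i Num.min (s 0 i) t <=
    \sum_i Num.min (a 0 i) t + \sum_i Num.min (b 0 i) t.
Proof.
move=> sA sB sX t0; set X := A + B in sX.
(* [A] and [B] are split at the level [t]: the singular values above [t] go into the rank part [Z],
   the others into the nuclear part. By [hiE] this attains the infimum for each of them. The
   projection [1 - Q] then kills [Z]. *)
pose lo (c : 'rV[R]_m) : 'rV[R]_m := \row_i (if t < c 0 i then 0 else c 0 i).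
pose hi (c : 'rV[R]_m) : 'rV[R]_m := \row_i (if t < c 0 i then c 0 i else 0).
have lohi c : diag_mx c = diag_mx (lo c) + diag_mx (hi c).
  rewrite -linearD /=; congr diag_mx; apply/rowP => i; rewrite !mxE.
  by case: ifP; rewrite ?addr0 ?add0r.
pose Z := UA *m diag_mx (hi a) *m VA + UB *m diag_mx (hi b) *m VB.
have [Q [pQ QZ trQ _]] := orth_proj_exists Z.
have pQ' := orth_projC pQ.
(* This is the polar factor of [X], so that pairing [X] with [W] gives the sum of its singular
   values. *)
pose W := U *m V.
have WE : W^T *m W = V^T *m V.
  by rewrite /W trmx_mul mulmxA -(mulmxA V^T) (svd_UtU sX) mulmx1.
have pW : orth_proj (W^T *m W).
  rewrite WE; split; first by rewrite trmx_mul trmxK.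
  by rewrite !mulmxA -(mulmxA V^T) -mulmxA (svd_VVtV sX).
have QX : (1%:M - Q) *m X = (1%:M - Q) *m (UA *m diag_mx (lo a) *m VA) +
    (1%:M - Q) *m (UB *m diag_mx (lo b) *m VB).
  have -> : X = UA *m diag_mx (lo a) *m VA + UB *m diag_mx (lo b) *m VB + Z.
    rewrite /X (svdE sA) (svdE sB) (lohi a) (lohi b) /Z !mulmxDr !mulmxDl.
    by rewrite -!addrA; congr (_ + _); rewrite addrCA.
  have QZ0 : (1%:M - Q) *m Z = 0 by rewrite mulmxBl mul1mx QZ subrr.
  by rewrite mulmxDr QZ0 addr0 mulmxDr.
(* [q i] is the squared norm of the projection by [Q] of the [i]-th left singular vector of [X];
   these weights lie in [[0, 1]] and add up to the rank of [Z]. *)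
pose q i := (U^T *m Q *m U) i i.
have q0 i : 0 <= q i by rewrite /q -{2}[U]trmxK orth_proj_quad_ge0.
have q1 i : q i <= 1.
  rewrite /q -{2}[U]trmxK; apply: le_trans (orth_proj_quad_le _ _ pQ) _.
  by rewrite trmxK (svd_UtU sX) mxE eqxx.
have trX : \tr ((1%:M - Q) *m X *m W^T) = \sum_i s 0 i * (1 - q i).
  have -> : \tr ((1%:M - Q) *m X *m W^T) =
      \tr (diag_mx s *m (U^T *m (1%:M - Q) *m U)).
    rewrite /W trmx_mul -mulmxA (mulmxA X) (svd_mulVt sX) mxtrace_mulC.
    by rewrite -!mulmxA mxtrace_mulC !mulmxA.
  rewrite mul_diag_mx /mxtrace; apply: eq_bigr => i _; rewrite mxE; congr (_ * _).
  rewrite mulmxBr mulmx1 mulmxBl (svd_UtU sX) /q.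
  by move: (U^T *m Q *m U) => T; rewrite !mxE eqxx.
have sumq : \sum_i q i = \tr Q.
  by rewrite -[in RHS](mulmx1 Q) -(svd_UUt sX) mulmxA [RHS]mxtrace_mulC mulmxA.
have hiE (c : 'rV[R]_m) : (forall i, 0 <= c 0 i) ->
    \sum_i Num.min (c 0 i) t =
    \sum_i lo c 0 i + (\rank (diag_mx (hi c)))%:R * t.
  move=> c0; rewrite rank_diag_mx -sum1_card natr_sum mulr_suml.
  rewrite [X in _ + X]big_mkcond -big_split /=.
  apply: eq_bigr => i _; rewrite !mxE inE !mxE.
  case: ltP => ct; rewrite ?eqxx ?addr0 //.
  by rewrite gt_eqF /= ?add0r ?mul1r // (le_lt_trans t0).
have hi_rank : (\rank Z)%:R <=
    (\rank (diag_mx (hi a)))%:R + (\rank (diag_mx (hi b)))%:R :> R.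
  rewrite -natrD ler_nat; apply: leq_trans (mxrank_add _ _) _; apply: leq_add;
  exact: leq_trans (mxrankM_maxl _ _) (mxrankM_maxr _ _).
have lo_ge0 (c : 'rV[R]_m) : (forall i, 0 <= c 0 i) -> forall i, 0 <= lo c 0 i.
  by move=> c0 i; rewrite mxE; case: ifP.
have a0 := svd_ge0 sA; have b0 := svd_ge0 sB.
have dual : \sum_i s 0 i * (1 - q i) <= \sum_i lo a 0 i + \sum_i lo b 0 i.
  rewrite -trX QX mulmxDl mxtraceD; apply: lerD.
    exact: mxtrace_dual_le sA (lo_ge0 _ a0) pQ' pW.
  exact: mxtrace_dual_le sB (lo_ge0 _ b0) pQ' pW.
(* The minimum of [s 0 i] and [t] is at most their convex combination with weight [q i]. *)
apply: (@le_trans _ _ (\sum_i (s 0 i * (1 - q i) + q i * t))).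
  apply: ler_sum => i _.
  have := q0 i; have := q1 i; move: (s 0 i) (q i) => x p p1 p0.
  have [xt|/ltW xt] := leP x t.
    have : 0 <= p * (t - x) by rewrite mulr_ge0 // subr_ge0.
    by lra.
  have : 0 <= (1 - p) * (x - t) by rewrite mulr_ge0 // subr_ge0.
  by lra.
rewrite big_split /= -mulr_suml sumq trQ (hiE _ a0) (hiE _ b0) addrACA.
by apply: lerD => //; rewrite -mulrDl ler_wpM2r.
Qed.

End MinSubadditive.

(** * Concave functions and majorization *)

(* Concave and nondecreasing on [0, +oo[: a supergradient [g >= 0] everywhere. *)
Definition increasing_concave (R : realType) (f : R -> R) :=
  forall y, 0 < y ->
    exists2 g, 0 <= g & forall x, 0 <= x -> f x <= f y + g * (x - y).

Section IncreasingConcave.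
Variables (R : realType) (f : R -> R).
Hypotheses (f0 : f 0 = 0) (fc : increasing_concave f).

Lemma increasing_concave_le x y : 0 <= x -> x <= y -> f x <= f y.
Proof.
move=> x0 xy; have [y0|y0] := leP y 0.
  by have -> : x = y by apply/le_anti; rewrite xy (le_trans y0).
have [g g0 /(_ x x0)/le_trans] := fc y0; apply.
by rewrite gerDl mulr_ge0_le0 // subr_le0.
Qed.

Lemma increasing_concave_ge0 x : 0 <= x -> 0 <= f x.
Proof. by move=> x0; rewrite -f0 increasing_concave_le. Qed.

(** That is, [f x / x] is nonincreasing, without a division by 0. The supergradient at the smaller
    point [x] is tested at 0 and at [y]. *)
Lemma increasing_concave_star x y : 0 <= x -> x <= y -> x * f y <= y * f x.
Proof.
move=> x0 xy; have [->|x_neq0] := eqVneq x 0; first by rewrite f0 mul0r mulr0.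
have {x0 x_neq0}x0 : 0 < x by rewrite lt_neqAle eq_sym x_neq0.
have [g g0 fg] := fc x0.
have := fg 0 (lexx _); rewrite f0 sub0r => f0g.
have := fg y (le_trans (ltW x0) xy) => fyg.
have : (y - x) * (f x + g * - x) >= 0 by rewrite mulr_ge0 // subr_ge0.
have : x * f y <= x * (f x + g * (y - x)) by rewrite ler_pM2l.
by lra.
Qed.

(** This is Abel summation as an inequality: in the induction step [d N.+1 * M N.+1] is subtracted,
    and the induction hypothesis pays for it since [d N.+1 <= d N]. *)
Lemma slope_sum_ge (d M : nat -> R) N : (forall j, (j <= N)%N -> 0 <= d j) ->
  (forall j, (j < N)%N -> d j.+1 <= d j) -> M 0%N = 0 -> (forall j, 0 <= M j) ->
  d N * M N.+1 <= \sum_(j < N.+1) d j * (M j.+1 - M j).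
Proof.
elim: N => [|N IHN] d0 dS M0 Mge0; first by rewrite big_ord1 M0 subr0.
rewrite big_ord_recr /= mulrBr addrC -addrA lerDl addrC subr_ge0.
apply: le_trans (IHN _ _ M0 Mge0); last first.
- by move=> j jN; apply: dS; rewrite ltnS ltnW.
- by move=> j jN; apply: d0; rewrite ltnW.
by rewrite ler_wpM2r // dS.
Qed.

(* On the breakpoints [p 0 = 0 < p 1 < ... < p N], [f] agrees with a piecewise
   linear function whose slopes decrease, so that Abel summation applies. *)
Lemma sum_le_of_min_grid (p : nat -> R) (N : nat) (a b : seq R) :
  p 0%N = 0 -> (forall j, (j < N)%N -> p j < p j.+1) ->
  (forall x, x \in a ++ b -> exists2 k, (k <= N)%N & x = p k) ->
  (forall t, 0 <= t -> \sum_(x <- a) Num.min x t <= \sum_(x <- b) Num.min x t) ->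
  \sum_(x <- a) f x <= \sum_(x <- b) f x.
Proof.
move=> p0 plt pab Hmin; pose d j := (f (p j.+1) - f (p j)) / (p j.+1 - p j).
have pmono j k : (j <= k)%N -> (k <= N)%N -> p j <= p k.
  elim: k => [|k IHk]; first by rewrite leqn0 => /eqP ->.
  rewrite leq_eqVlt => /orP[/eqP -> //|jk kN].
  by apply: (le_trans (IHk _ (ltnW kN)) (ltW (plt _ kN))).
have p_ge0 j : (j <= N)%N -> 0 <= p j by move=> jN; rewrite -p0 pmono.
have d_ge0 j : (j < N)%N -> 0 <= d j.
  move=> jN; apply: divr_ge0; rewrite subr_ge0; last exact/ltW/plt.
  by apply: increasing_concave_le; [exact/p_ge0/ltnW | exact/ltW/plt].
have dS j : (j.+1 < N)%N -> d j.+1 <= d j.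
  move=> jN; have jN' := ltnW jN.
  have pj : 0 < p j.+1 by apply: le_lt_trans (plt _ jN'); rewrite p_ge0 // ltnW.
  (* The supergradient at the common endpoint lies between the two adjacent slopes. *)
  have [g g0 fg] := fc pj; apply: (@le_trans _ _ g).
    rewrite ler_pdivrMr ?subr_gt0 ?plt // lerBlDl.
    by apply: fg; apply: p_ge0.
  rewrite ler_pdivlMr ?subr_gt0 ?plt //.
  by have := fg (p j) (p_ge0 _ (ltnW jN')); lra.
(* At [x = p k] the difference of the truncations is the length of the [j]-th interval if [j < k]
   and 0 otherwise, so the sum telescopes to [f (p k)]. *)
have fE x : x \in a ++ b ->
    f x = \sum_(j < N) d j * (Num.min x (p j.+1) - Num.min x (p j)).
  move=> /pab[k kN ->].
  transitivity (\sum_(0 <= j < k) (f (p j.+1) - f (p j))).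
    by rewrite telescope_sumr // p0 f0 subr0.
  rewrite -(big_mkord xpredT
    (fun j => d j * (Num.min (p k) (p j.+1) - Num.min (p k) (p j)))).
  rewrite (big_cat_nat _ kN) //= [X in _ + X]big_nat_cond [X in _ + X]big1 ?addr0.
    rewrite !big_nat; apply: eq_bigr => j /= jk.
    rewrite !min_r ?pmono ?(leq_trans _ kN) // 1?ltnW //.
    by rewrite divfK // subr_eq0 gt_eqF // plt // (leq_trans jk).
  move=> j /andP[/andP[kj jN] _].
  by rewrite !min_l ?pmono // 1?ltnW // subrr mulr0.
pose M j := \sum_(x <- b) Num.min x (p j) - \sum_(x <- a) Num.min x (p j).
(* [slope_sum_ge] asks for nonnegativity at every index, while [p j] is controlled only up to
   [N]. *)
pose M' j := if (j <= N)%N then M j else 0.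
rewrite -subr_ge0; have -> : \sum_(x <- b) f x - \sum_(x <- a) f x =
    \sum_(j < N) d j * (M' j.+1 - M' j).
  have swap s : {subset s <= a ++ b} -> \sum_(x <- s) f x =
      \sum_(j < N) d j * \sum_(x <- s) (Num.min x (p j.+1) - Num.min x (p j)).
    move=> sab; rewrite big_seq; under eq_bigr => x xs do rewrite fE ?sab //.
    rewrite -big_seq exchange_big /=.
    by apply: eq_bigr => j _; rewrite mulr_sumr.
  rewrite !swap; try by move=> x xs; rewrite mem_cat xs ?orbT.
  rewrite -sumrB; apply: eq_bigr => j _; rewrite -mulrBr; congr (_ * _).
  by rewrite !sumrB /M' /M (ltn_ord j) (ltnW (ltn_ord j)); ring.
have M'ge0 j : 0 <= M' j.
  by rewrite /M'; case: ifP => // jN; rewrite subr_ge0 Hmin // p_ge0.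
have M'0 : M' 0%N = 0.
  apply/le_anti; rewrite M'ge0 andbT /M' /= /M p0 subr_le0 le_eqVlt.
  apply/orP; left.
  have min0 s : {subset s <= a ++ b} -> \sum_(x <- s) Num.min x 0 = 0.
    move=> sab; rewrite big_seq big1 // => x /sab /pab[k kN ->].
    by rewrite min_r // p_ge0.
  by rewrite !min0 // => x xs; rewrite mem_cat xs ?orbT.
case: N d_ge0 dS M' M'ge0 M'0 {plt pab pmono p_ge0 fE} =>
  [|N] d_ge0 dS M' M'ge0 M'0.
  by rewrite big_ord0.
apply: le_trans (slope_sum_ge _ _ M'0 M'ge0) => //.
by rewrite mulr_ge0 // d_ge0.
Qed.

(** The grid consists of 0 followed by the distinct positive entries of both lists in increasing
    order. *)
Lemma sum_le_of_sum_min (a b : seq R) : (forall x, x \in a ++ b -> 0 <= x) ->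
  (forall t, 0 <= t -> \sum_(x <- a) Num.min x t <= \sum_(x <- b) Num.min x t) ->
  \sum_(x <- a) f x <= \sum_(x <- b) f x.
Proof.
move=> ab0; pose s := sort <=%R (undup [seq x <- a ++ b | 0 < x]).
have s_path : path <%R 0 (s : seq R).
  rewrite (path_sortedE lt_trans) sort_lt_sorted undup_uniq andbT.
  by apply/allP => x; rewrite mem_sort mem_undup mem_filter => /andP[].
apply: (@sum_le_of_min_grid (nth 0 (0 :: s)) (size s)) => //.
  by move=> j jN; apply: (pathP 0 s_path).
move=> x xab; have [x0|x0] := leP x 0.
  by exists 0%N => //; apply/le_anti; rewrite x0 ab0.
have xs : x \in s by rewrite mem_sort mem_undup mem_filter x0.
by exists (index x s).+1; rewrite ?index_mem //= nth_index.
Qed.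

End IncreasingConcave.

Section Tl.
Variables (R : realType) (alpha epsilon : R).
Hypotheses (halpha : 0 <= alpha <= 1 / 2) (hepsilon : 0 < epsilon).
Local Notation f := (tl alpha epsilon).

Lemma tl0 : f 0 = 0.
Proof. by rewrite /tl powR0 ?mul0r // mul1r invr_neq0 // pnatr_eq0. Qed.

Lemma tl_gt0 x : 0 < x -> 0 < f x.
Proof. by move=> x0; rewrite divr_gt0 ?powR_gt0 // addr_gt0. Qed.

Lemma tl_expR x : 0 < x ->
  f x = expR (1 / 2 * ln x - (1 / 2 - alpha) * ln (x + epsilon)).
Proof. by move=> x0; rewrite expRB /tl /powR !gt_eqF ?addr_gt0. Qed.

Lemma ln_le_tangent (x y : R) : 0 < x -> 0 < y -> ln x <= ln y + x / y - 1.
Proof.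
move=> x0 y0; have := expR_ge1Dx (ln (x / y)).
by rewrite lnK ?posrE ?divr_gt0 // ln_div ?posrE //; lra.
Qed.

(* Weighted AM-GM for [x / y], [x (y + epsilon) / (y (x + epsilon))] and [1]
   with weights [alpha], [1 / 2 - alpha] and [1 / 2]. *)
Lemma tl_increasing_concave : increasing_concave f.
Proof.
move=> y y0; have [al0 al1] := andP halpha; pose c := 1 / 2 - alpha.
have c0 : 0 <= c by rewrite subr_ge0.
have fy := tl_gt0 y0; have ye : 0 < y + epsilon by rewrite addr_gt0.
(* [g] is the logarithmic derivative [1 / (2 y) - c / (y + epsilon)] of [f] at [y], written as a sum
   of nonnegative terms; the supergradient is the derivative [f y * g]. *)
pose g := alpha / y + c * (epsilon / (y * (y + epsilon))).
have g0 : 0 <= g.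
  apply: addr_ge0; first by rewrite divr_ge0 // ltW.
  by rewrite mulr_ge0 // divr_ge0 ?mulr_ge0 // ltW.
(* This makes the tangent at [y] nonnegative at 0 and, below, [S] positive. *)
have gy : g * y <= 1 / 2.
  have -> : g * y = alpha + c * (epsilon / (y + epsilon)).
    by rewrite /g; field; rewrite !gt_eqF.
  have : c * (epsilon / (y + epsilon)) <= c.
    by rewrite ler_piMr // ler_pdivrMr // mul1r lerDr ltW.
  by rewrite /c; lra.
exists (f y * g); first by rewrite mulr_ge0 // ltW.
move=> x; rewrite le_eqVlt => /predU1P[<-|x0].
  rewrite tl0 sub0r -mulrA mulrN -{1}[f y]mulr1 -mulrDr mulr_ge0 ?ltW //.
  by lra.
have xe : 0 < x + epsilon by rewrite addr_gt0.
pose S := 1 + g * (x - y).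
have S0 : 0 < S by rewrite /S; have := mulr_ge0 g0 (ltW x0); lra.
have -> : f y + f y * g * (x - y) = f y * S by rewrite /S; ring.
pose a := x / y; pose b := x * (y + epsilon) / (y * (x + epsilon)).
have a0 : 0 < a by rewrite divr_gt0.
have b0 : 0 < b by rewrite divr_gt0 ?mulr_gt0.
have abS : alpha * a + c * b + 1 / 2 <= S.
  (* As a function of [x], [b] is concave; the right-hand side is its tangent at [y]. *)
  have bt : b <= 1 + (x - y) * (epsilon / (y * (y + epsilon))).
    rewrite -subr_ge0.
    have -> : 1 + (x - y) * (epsilon / (y * (y + epsilon))) - b =
        epsilon * (x - y) ^+ 2 / (y * (y + epsilon) * (x + epsilon)).
      by rewrite /b; field; rewrite !gt_eqF.
    apply: divr_ge0; first by rewrite mulr_ge0 ?sqr_ge0 // ltW.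
    by rewrite ltW // !mulr_gt0.
  have := ler_wpM2l c0 bt.
  have -> : alpha * a = alpha + (x - y) * (alpha / y).
    by rewrite /a; field; rewrite gt_eqF.
  by rewrite /S /g /c; lra.
(* Here [f x / f y = a^alpha * b^c * 1^(1/2)]. Each of [ln a], [ln b] and [ln 1] is bounded by the
   tangent of [ln] at [S]; the weights add up to 1, and [abS] absorbs the linear terms. *)
rewrite (tl_expR x0) (tl_expR y0) -[S](@lnK R) ?posrE // -expRD ler_expR.
have la : ln a = ln x - ln y by rewrite ln_div ?posrE.
have lb : ln b = ln x + ln (y + epsilon) - ln y - ln (x + epsilon).
  by rewrite ln_div ?posrE ?mulr_gt0 // !lnM ?posrE //; ring.
have := ler_wpM2l al0 (ln_le_tangent a0 S0).
have := ler_wpM2l c0 (ln_le_tangent b0 S0).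
have := ln_le_tangent ltr01 S0; rewrite ln1 la lb.
have : (alpha * a + c * b + 1 / 2) / S <= 1.
  by rewrite ler_pdivrMr // [1 * S]mul1r.
rewrite /c; move: (ln S) (ln x) (ln y) (ln (x + epsilon)) (ln (y + epsilon)).
move=> L1 L2 L3 L4 L5.
by clear -S; clearbody S; move: (S^-1) a b => T a b; lra.
Qed.

End Tl.

(** * Subadditivity of TL *)

Section TLTheory.
Variables (R : realType) (m n : nat) (alpha epsilon : R).
Hypotheses (halpha : 0 <= alpha <= 1 / 2) (hepsilon : 0 < epsilon).
Implicit Types A B X Y : 'M[R]_(m, n).
Local Notation TL := (TL alpha epsilon).
Local Notation f := (tl alpha epsilon).

Lemma TL_opp X : TL (- X) = TL X.
Proof.
have [U [s [V sX]]] := svd_exists X.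
by rewrite (svd_TL (svd_opp sX)) (svd_TL sX).
Qed.

(** The singular values of [A + B] are compared with the concatenation of those of [A] and of [B],
    for which [sum_min_svd_subadd] is the required family of inequalities. *)
Lemma TL_subadd A B : TL (A + B) <= TL A + TL B.
Proof.
have [UA [a [VA sA]]] := svd_exists A; have [UB [b [VB sB]]] := svd_exists B.
have [U [s [V sX]]] := svd_exists (A + B).
rewrite (svd_TL sA) (svd_TL sB) (svd_TL sX).
pose ls (c : 'rV[R]_m) := [seq c 0 i | i <- enum 'I_m].
have lsE (c : 'rV[R]_m) (g : R -> R) : \sum_i g (c 0 i) = \sum_(x <- ls c) g x.
  by rewrite big_map big_enum.
rewrite !lsE -big_cat; apply: sum_le_of_sum_min.
- exact: tl0.
- exact: tl_increasing_concave.
- move=> x; rewrite !mem_cat => /or3P[] /mapP[i _ ->].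
  + exact: svd_ge0 sX i.
  + exact: svd_ge0 sA i.
  + exact: svd_ge0 sB i.
move=> t t0; rewrite big_cat /= -!(lsE _ (fun x => Num.min x t)).
exact: sum_min_svd_subadd sA sB sX t0.
Qed.

(** The Gram matrices add up and their product is 0, so the spectrum for [X + Y] together with [m]
    zeros is a permutation of the two spectra; the zeros contribute [f 0 = 0]. *)
Lemma TL_add_orthogonal X Y : X *m Y^T = 0 -> X^T *m Y = 0 ->
  TL (X + Y) = TL X + TL Y.
Proof.
move=> XYt XtY.
have [UX [a [VX sX]]] := svd_exists X; have [UY [b [VY sY]]] := svd_exists Y.
have [U [c [V sXY]]] := svd_exists (X + Y).
rewrite (svd_TL sX) (svd_TL sY) (svd_TL sXY).
have gram : (X + Y) *m (X + Y)^T = X *m X^T + Y *m Y^T.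
  rewrite [(X + Y)^T]linearD /= mulmxDl !mulmxDr XYt.
  have -> : Y *m X^T = 0 by rewrite -[Y]trmxK -trmx_mul XYt trmx0.
  by rewrite addr0 add0r.
have gram0 : (X *m X^T) *m (Y *m Y^T) = 0.
  by rewrite mulmxA -(mulmxA X) XtY mulmx0 mul0mx.
pose ls (d : 'rV[R]_m) := [seq d 0 i ^+ 2 | i <- enum 'I_m].
have cp (Z : 'M[R]_(m, n)) W (d : 'rV[R]_m) T : svd Z W d T ->
    char_poly (Z *m Z^T) = \prod_(x <- ls d) ('X - x%:P).
  move=> sZ; rewrite (svd_gram sZ) (char_poly_conj_diag _ (svd_UUt sZ)).
  by rewrite big_map big_enum; apply: eq_bigr => i _; rewrite mxE.
have := char_poly_add_orthogonal gram0; rewrite -gram.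
rewrite (cp _ _ _ _ sX) (cp _ _ _ _ sY) (cp _ _ _ _ sXY) -big_cat.
have -> : 'X ^+ m = \prod_(x <- nseq m (0 : R)) ('X - x%:P).
  by rewrite big_nseq polyC0 subr0 -Monoid.iteropE.
rewrite -big_cat => /prod_XsubC_eq spectra.
have : \sum_(x <- ls a ++ ls b) f (Num.sqrt x) =
    \sum_(x <- nseq m 0 ++ ls c) f (Num.sqrt x) by exact: perm_big.
have lsE (Z : 'M[R]_(m, n)) W (d : 'rV[R]_m) T : svd Z W d T ->
    \sum_(x <- ls d) f (Num.sqrt x) = \sum_i f (d 0 i).
  move=> sZ; rewrite big_map big_enum; apply: eq_bigr => i _.
  by rewrite sqrtr_sqr ger0_norm // (svd_ge0 sZ).
rewrite !big_cat /= (lsE _ _ _ _ sX) (lsE _ _ _ _ sY) (lsE _ _ _ _ sXY) => ->.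
rewrite [X in _ = X + _]big1_seq ?add0r // => x /andP[_] /nseqP[-> _].
by rewrite sqrtr0 tl0.
Qed.

End TLTheory.

(** * Norms and restricted isometry constants *)

Section Norms.
Variable R : realType.

Lemma frobenius_norm_ge0 m n (X : 'M[R]_(m, n)) : 0 <= frobenius_norm X.
Proof. exact: sqrtr_ge0. Qed.

Lemma euclidean_norm_ge0 d (v : 'cV[R]_d) : 0 <= euclidean_norm v.
Proof. exact: sqrtr_ge0. Qed.

Lemma sqr_frobenius_norm m n (X : 'M[R]_(m, n)) :
  frobenius_norm X ^+ 2 = \tr (X *m X^T).
Proof.
rewrite sqr_sqrtr; last by do 2 (apply: sumr_ge0 => ? _); rewrite sqr_ge0.
by rewrite mxtrace_mul_tr; do 2 (apply: eq_bigr => ? _).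
Qed.

Lemma sqr_euclidean_norm d (v : 'cV[R]_d) :
  euclidean_norm v ^+ 2 = \sum_i v i 0 ^+ 2.
Proof. by rewrite sqr_sqrtr // sumr_ge0 // => i _; rewrite sqr_ge0. Qed.

Lemma frobenius_norm_eq0 m n (X : 'M[R]_(m, n)) : frobenius_norm X = 0 -> X = 0.
Proof.
move=> X0; apply: mxtrace_gram_eq0.
by rewrite -sqr_frobenius_norm X0 expr0n.
Qed.

Lemma euclidean_normN d (v : 'cV[R]_d) : euclidean_norm (- v) = euclidean_norm v.
Proof. by congr Num.sqrt; apply: eq_bigr => i _; rewrite mxE sqrrN. Qed.

Lemma euclidean_norm_eq0 d (v : 'cV[R]_d) : euclidean_norm v = 0 -> v = 0.
Proof.
move=> v0; have /eqP := sqr_euclidean_norm v; rewrite v0 expr0n eq_sym psumr_eq0.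
  move=> /allP v_eq0; apply/matrixP => i j; rewrite ord1 mxE.
  by have := v_eq0 i (mem_index_enum _); rewrite sqrf_eq0 => /eqP.
by move=> i _; rewrite sqr_ge0.
Qed.

Lemma cauchy_schwarz d (v w : 'cV[R]_d) :
  \sum_i v i 0 * w i 0 <= euclidean_norm v * euclidean_norm w.
Proof.
have [v0|v_neq0] := eqVneq (euclidean_norm v) 0.
  rewrite v0 mul0r (euclidean_norm_eq0 v0) big1 // => i _.
  by rewrite mxE mul0r.
have [w0|w_neq0] := eqVneq (euclidean_norm w) 0.
  rewrite w0 mulr0 (euclidean_norm_eq0 w0) big1 // => i _.
  by rewrite [(0 : 'cV_d) i 0]mxE mulr0.
have := sqr_euclidean_norm v; have := sqr_euclidean_norm w.
move: (euclidean_norm_ge0 v) (euclidean_norm_ge0 w) v_neq0 w_neq0.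
move: (euclidean_norm v) (euclidean_norm w) => p q p0 q0 p_neq0 q_neq0 wq vp.
have {p_neq0}p0 : 0 < p by rewrite lt_neqAle eq_sym p_neq0.
have {q_neq0}q0 : 0 < q by rewrite lt_neqAle eq_sym q_neq0.
have : 0 <= \sum_i (q * v i 0 - p * w i 0) ^+ 2.
  by apply: sumr_ge0 => i _; rewrite sqr_ge0.
have -> : \sum_i (q * v i 0 - p * w i 0) ^+ 2 =
    q ^+ 2 * \sum_i v i 0 ^+ 2 + p ^+ 2 * \sum_i w i 0 ^+ 2 -
    2 * (p * q) * \sum_i v i 0 * w i 0.
  rewrite !mulr_sumr -big_split -sumrB; apply: eq_bigr => i _ /=; ring.
rewrite -wq -vp; move: (\sum_i _) => S h.
rewrite -(ler_pM2l (mulr_gt0 p0 q0)); lra.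
Qed.

Lemma euclidean_norm_triangle d (v w : 'cV[R]_d) :
  euclidean_norm (v + w) <= euclidean_norm v + euclidean_norm w.
Proof.
rewrite -(ler_pXn2r (n := 2)) ?nnegrE ?addr_ge0 ?euclidean_norm_ge0 //.
rewrite sqrrD !sqr_euclidean_norm.
have -> : \sum_i (v + w) i 0 ^+ 2 =
    \sum_i v i 0 ^+ 2 + (\sum_i v i 0 * w i 0) *+ 2 + \sum_i w i 0 ^+ 2.
  by rewrite -sumrMnl -!big_split; apply: eq_bigr => i _ /=; rewrite mxE sqrrD.
by rewrite lerD2r lerD2l lerMn2r /= cauchy_schwarz.
Qed.

(** A crude constant suffices: it serves to show that some restricted isometry constant exists. *)
Lemma linear_bounded m n d (A : {linear 'M[R]_(m, n) -> 'cV[R]_d}) :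
  exists2 C, 0 <= C &
    forall X, euclidean_norm (A X) ^+ 2 <= C * frobenius_norm X ^+ 2.
Proof.
pose c l := \sum_i \sum_j `|A (delta_mx i j) l 0|.
exists (\sum_l c l ^+ 2); first by apply: sumr_ge0 => l _; rewrite sqr_ge0.
move=> X; rewrite sqr_euclidean_norm mulr_suml; apply: ler_sum => l _.
have c0 : 0 <= c l by do 2 (apply: sumr_ge0 => ? _).
rewrite -exprMn -real_normK ?num_real // lerXn2r ?nnegrE //.
  by rewrite mulr_ge0 ?frobenius_norm_ge0.
have -> : A X l 0 = \sum_i \sum_j X i j * A (delta_mx i j) l 0.
  rewrite {1}(matrix_sum_delta X) linear_sum summxE; apply: eq_bigr => i _.
  rewrite linear_sum summxE; apply: eq_bigr => j _.
  by rewrite linearZ mxE.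
rewrite /c mulr_suml; apply: le_trans (ler_norm_sum _ _ _) (ler_sum _ _) => i _.
rewrite mulr_suml; apply: le_trans (ler_norm_sum _ _ _) (ler_sum _ _) => j _.
rewrite normrM mulrC ler_wpM2l // -sqrtr_sqr ler_wsqrtr //.
rewrite (bigD1 i) //= (bigD1 j) //= -!addrA lerDl addr_ge0 //.
  by apply: sumr_ge0 => ? _; rewrite sqr_ge0.
by do 2 (apply: sumr_ge0 => ? _); rewrite sqr_ge0.
Qed.

End Norms.

Section Ric.
Variables (R : realType) (m n d : nat).
Variables (A : {linear 'M[R]_(m, n) -> 'cV[R]_d}) (r : nat).
Hypotheses (r_gt0 : (0 < r)%N) (m_gt0 : (0 < m)%N) (n_gt0 : (0 < n)%N).

Lemma unit_frobenius_norm_of_small_rank : exists X : 'M[R]_(m, n),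
  (\rank X <= r)%N /\ frobenius_norm X ^+ 2 = 1.
Proof.
exists (delta_mx (Ordinal m_gt0) (Ordinal n_gt0)); split.
  by rewrite mxrank_delta.
rewrite sqr_frobenius_norm trmx_delta mul_delta_mx /mxtrace.
rewrite (bigD1 (Ordinal m_gt0)) //= big1 ?addr0 => [|i i0].
  by rewrite mxE !eqxx.
by rewrite mxE (negPf i0).
Qed.

Lemma restricted_isometry_ge0 delta : restricted_isometry A r delta -> 0 <= delta.
Proof.
have [X [rX F1]] := unit_frobenius_norm_of_small_rank.
move=> /(_ X rX); rewrite F1 !mulr1 => -[h1 h2].
by have := le_trans h1 h2; lra.
Qed.

(** For fixed [X] both inequalities are nonstrict and affine in the constant, so they pass to the
    infimum. Hence the minimum exists and [xget] does not return its default. *)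
Lemma ric_restricted_isometry : restricted_isometry A r (ric A r).
Proof.
pose D := [set delta | restricted_isometry A r delta].
suff Dinf : restricted_isometry A r (inf D).
  have ex : exists delta, [set delta | restricted_isometry A r delta /\
    forall delta', restricted_isometry A r delta' -> delta <= delta'] delta.
    exists (inf D); split => // delta Ddelta; apply: ge_inf => //.
    by exists 0 => x; exact: restricted_isometry_ge0.
  by have [] := xgetPex 0 ex.
have D0 : D !=set0.
  have [C C0 AC] := linear_bounded A.
  exists (1 + C) => X _; have := AC X; have := sqr_ge0 (frobenius_norm X).
  have := sqr_ge0 (euclidean_norm (A X)).
  move: (_ ^+ 2) (_ ^+ 2) => e F e0 F0 eF; have := mulr_ge0 C0 F0.
  by split; lra.
move=> X rX; have [F0|F_neq0] := eqVneq (frobenius_norm X ^+ 2) 0.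
  by have [delta /(_ X rX)] := D0; rewrite F0 !mulr0.
have F0 : 0 < frobenius_norm X ^+ 2 by rewrite lt_neqAle eq_sym F_neq0 sqr_ge0.
split.
  rewrite -ler_pdivlMr // lerBlDr -lerBlDl.
  apply: lb_le_inf => // delta /(_ X rX)[h _].
  by rewrite lerBlDl -lerBlDr ler_pdivlMr.
rewrite -ler_pdivrMr // -lerBlDl; apply: lb_le_inf => // delta /(_ X rX)[_ h].
by rewrite lerBlDl ler_pdivrMr.
Qed.

Lemma ric_lower X : (\rank X <= r)%N ->
  Num.sqrt (1 - ric A r) * frobenius_norm X <= euclidean_norm (A X).
Proof.
move=> rX; have [h _] := ric_restricted_isometry rX.
rewrite -[euclidean_norm _]ger0_norm ?euclidean_norm_ge0 // -sqrtr_sqr.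
(* If [1 - ric A r] is negative, its [Num.sqrt] is 0 and the bound is trivial. *)
apply: le_trans (ler_wsqrtr h); have [r1|/ltW r1] := leP 0 (1 - ric A r).
  by rewrite sqrtrM // sqrtr_sqr ger0_norm // frobenius_norm_ge0.
by rewrite ler0_sqrtr // mul0r sqrtr_ge0.
Qed.

Lemma ric_upper X : (\rank X <= r)%N ->
  euclidean_norm (A X) <= Num.sqrt (1 + ric A r) * frobenius_norm X.
Proof.
move=> rX; have [_ h] := ric_restricted_isometry rX.
rewrite -[euclidean_norm _]ger0_norm ?euclidean_norm_ge0 // -sqrtr_sqr.
apply: le_trans (ler_wsqrtr h) _; rewrite sqrtrM.
  by rewrite sqrtr_sqr ger0_norm // frobenius_norm_ge0.
by rewrite addr_ge0 // restricted_isometry_ge0 //; exact: ric_restricted_isometry.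
Qed.

End Ric.

(** * Singular value truncations *)

(** The choice is greedy: a maximal element outside [B] is added and its value becomes the threshold
    [c], which separates [B] from the rest of [E]. For [k = 0] the sum of all values is a valid
    threshold. *)
Lemma largest_subset (R : realDomainType) (I : finType) (t : I -> R)
    (E : {set I}) (k : nat) :
  (forall i, 0 <= t i) -> (k <= #|E|)%N ->
  exists (B : {set I}) (c : R), [/\ B \subset E, #|B| = k, 0 <= c,
    forall i, i \in B -> c <= t i & forall i, i \in E :\: B -> t i <= c].
Proof.
move=> t0; elim: k => [_|k IHk kE].
  exists finset.set0, (\sum_i t i); split; rewrite ?finset.sub0set ?cards0 ?sumr_ge0 //.
    by move=> i; rewrite inE.
  by move=> i _; rewrite (bigD1 i) //= lerDl sumr_ge0.
have [B [c [BE Bk c0 cB cEB]]] := IHk (ltnW kE).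
have [i0 i0EB] : exists i0, i0 \in E :\: B.
  apply/set0Pn; rewrite -card_gt0 cardsD (finset.setIidPr BE) Bk subn_gt0.
  exact: kE.
case: (@arg_maxP _ _ _ i0 (fun i => i \in E :\: B) t i0EB) => i iEB imax.
have [iE iB] : i \in E /\ i \notin B by move: iEB; rewrite inE => /andP[].
exists (i |: B), (t i); split => //.
- by rewrite finset.subUset finset.sub1set iE.
- by rewrite cardsU1 iB Bk.
- move=> j; rewrite finset.in_setU1 => /predU1P[-> //|jB].
  exact: le_trans (cEB _ iEB) (cB _ jB).
- move=> j; rewrite !inE negb_or => /andP[/andP[_ jB] jE].
  by apply: imax; rewrite inE jB.
Qed.

Definition mask_row (R : pzSemiRingType) (m : nat) (s : 'rV[R]_m)
    (E : {set 'I_m}) : 'rV[R]_m :=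
  \row_i (if i \in E then s 0 i else 0).

Section Truncation.
Variables (R : realType) (m n : nat) (X : 'M[R]_(m, n)).
Variables (U : 'M[R]_m) (s : 'rV[R]_m) (V : 'M[R]_(m, n)).
Hypothesis XE : svd X U s V.

Definition truncation (E : {set 'I_m}) : 'M[R]_(m, n) :=
  U *m diag_mx (mask_row s E) *m V.

Lemma truncation_rank E : (\rank (truncation E) <= #|E|)%N.
Proof.
apply: leq_trans (mxrankM_maxl _ _) (leq_trans (mxrankM_maxr _ _) _).
rewrite rank_diag_mx; apply/subset_leq_card/fintype.subsetP => i.
by rewrite inE mxE; case: ifP => //; rewrite eqxx.
Qed.

Lemma truncationT : truncation [set: 'I_m]%SET = X.
Proof.
rewrite (svdE XE); congr (_ *m diag_mx _ *m _).
by apply/rowP => i; rewrite mxE inE.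
Qed.

Lemma truncationD (E F : {set 'I_m}) : F \subset E ->
  truncation E = truncation F + truncation (E :\: F).
Proof.
move=> /fintype.subsetP FE; rewrite -mulmxDl -mulmxDr -linearD /=.
congr (_ *m diag_mx _ *m _); apply/rowP => i; rewrite !mxE inE.
by have [/FE ->|_] := boolP (i \in F); rewrite /= ?addr0 ?add0r.
Qed.

Lemma truncation_mxtrace_gram E :
  \tr (truncation E *m (truncation E)^T) = \sum_(i in E) s 0 i ^+ 2.
Proof.
have [_ _ VV _] := XE; rewrite /truncation !trmx_mul tr_diag_mx mxtrace_mulC.
rewrite !mulmxA -(mulmxA _ U^T) (svd_UtU XE) mulmx1 mxtrace_mulC !mulmxA.
rewrite VV !mulmx_diag mxtrace_diag [RHS]big_mkcond.
apply: eq_bigr => i _; rewrite !mxE.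
have [iE|] := boolP (i \in E); last by rewrite mulr0.
by have [->|] := eqVneq (s 0 i) 0; rewrite ?expr0n ?mulr0 ?mul1r ?expr2.
Qed.

(** Since [U *m diag_mx s = X *m V^T], the columns of a truncation stay in the column space of [X].
    With [truncation_mul] this keeps the truncations of [Dc] orthogonal to [D0]. *)
Lemma mul_truncation p (P : 'M[R]_(p, m)) E : P *m X = 0 -> P *m truncation E = 0.
Proof.
move=> PX; have PUs : P *m (U *m diag_mx s) = 0.
  by rewrite -(svd_mulVt XE) mulmxA PX mul0mx.
have -> : truncation E = U *m diag_mx s *m diag_mx (\row_i (i \in E)%:R) *m V.
  rewrite -(mulmxA U) mulmx_diag; congr (_ *m diag_mx _ *m _).
  by apply/rowP => i; rewrite !mxE; case: ifP; rewrite ?mulr1 ?mulr0.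
by rewrite !mulmxA -(mulmxA P) PUs !mul0mx.
Qed.

Lemma truncation_mul p (Q : 'M[R]_(n, p)) E : X *m Q = 0 -> truncation E *m Q = 0.
Proof.
move=> XQ; have sVQ : diag_mx s *m V *m Q = 0.
  by rewrite -(svd_mulUt XE) -mulmxA XQ mulmx0.
have -> : truncation E = U *m diag_mx (\row_i (i \in E)%:R) *m (diag_mx s *m V).
  rewrite mulmxA -(mulmxA U) mulmx_diag; congr (_ *m diag_mx _ *m _).
  by apply/rowP => i; rewrite !mxE; case: ifP; rewrite ?mul1r ?mul0r.
by rewrite -mulmxA sVQ mulmx0.
Qed.

Lemma truncation_norm_le (E : {set 'I_m}) k c : (#|E| <= k)%N -> 0 <= c ->
  (forall i, i \in E -> s 0 i <= c) ->
  frobenius_norm (truncation E) <= Num.sqrt k%:R * c.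
Proof.
move=> Ek c0 sc; have kc0 : 0 <= Num.sqrt k%:R * c by rewrite mulr_ge0 ?sqrtr_ge0.
rewrite -(ler_pXn2r (n := 2)) ?nnegrE ?frobenius_norm_ge0 //.
rewrite sqr_frobenius_norm truncation_mxtrace_gram exprMn sqr_sqrtr ?ler0n //.
apply: (@le_trans _ _ (\sum_(i in E) c ^+ 2)).
  by apply: ler_sum => i iE; rewrite lerXn2r ?nnegrE ?sc // (svd_ge0 XE).
by rewrite sumr_const -[_ *+ #|_|]mulr_natl ler_wpM2r ?sqr_ge0 // ler_nat.
Qed.

(* The singular values in [E] are split into decreasing blocks of size [k]: the
   norm of a block is at most [sqrt k] times its largest singular value, hence
   at most [1 / sqrt k] times the sum over the preceding block. *)
Lemma truncation_image_le d (A : {linear 'M[R]_(m, n) -> 'cV[R]_d}) k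
    (E : {set 'I_m}) c :
  (0 < k)%N -> (0 < m)%N -> (0 < n)%N ->
  0 <= c -> (forall i, i \in E -> s 0 i <= c) ->
  euclidean_norm (A (truncation E)) <=
    Num.sqrt ((1 + ric A k) / k%:R) * (k%:R * c + \sum_(i in E) s 0 i).
Proof.
move=> k0 m0 n0; set S := Num.sqrt (_ / _); have S0 : 0 <= S by exact: sqrtr_ge0.
have kR : 0 < k%:R :> R by rewrite ltr0n.
have block (F : {set 'I_m}) b :
    (#|F| <= k)%N -> 0 <= b -> (forall i, i \in F -> s 0 i <= b) ->
    euclidean_norm (A (truncation F)) <= S * (k%:R * b).
  move=> Fk b0 sb.
  apply: le_trans (ric_upper A k0 m0 n0 (leq_trans (truncation_rank F) Fk)) _.
  apply: le_trans (ler_wpM2l (sqrtr_ge0 _) (truncation_norm_le Fk b0 sb)) _.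
  have ric0 := restricted_isometry_ge0 k0 m0 n0 (ric_restricted_isometry A k0 m0 n0).
  have -> : Num.sqrt (1 + ric A k) = S * Num.sqrt k%:R.
    by rewrite -sqrtrM ?divr_ge0 ?addr_ge0 ?ler0n // divfK // gt_eqF.
  by rewrite mulrA -(mulrA S) -expr2 sqr_sqrtr ?ler0n // mulrA.
(* In this induction on the size of [E] the bound [c] varies: the top block [B] is charged to [c],
   and its threshold [b] is the bound for the rest, where [k b] is paid by the sum over [B]. *)
have [N] := ubnP #|E|; elim: N E c => // N IHN E c EN c0 sc.
have [Ek|/ltnW kE] := leqP #|E| k.
  apply: le_trans (block _ _ Ek c0 sc) _; rewrite ler_wpM2l // lerDl sumr_ge0 //.
  by move=> i _; exact: svd_ge0 XE i.
have [B [b [BE Bk b0 bB bEB]]] := largest_subset (svd_ge0 XE) kE.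
rewrite (truncationD BE) linearD.
apply: le_trans (euclidean_norm_triangle _ _) _.
have hB : euclidean_norm (A (truncation B)) <= S * (k%:R * c).
  by apply: block => //; [rewrite Bk | move=> i /(fintype.subsetP BE); exact: sc].
have hEB : euclidean_norm (A (truncation (E :\: B))) <=
    S * (k%:R * b + \sum_(i in E :\: B) s 0 i).
  apply: IHN => //; rewrite cardsD (finset.setIidPr BE) Bk.
  by rewrite ltn_subLR // (leq_trans EN) // -addn1 addnC leq_add2r.
apply: le_trans (lerD hB hEB) _; rewrite -mulrDr ler_wpM2l // lerD2l.
rewrite [leRHS](big_setID B) /= (finset.setIidPr BE) lerD2r.
have -> : k%:R * b = \sum_(i in B) b by rewrite sumr_const Bk mulr_natl.
exact: ler_sum.
Qed.

End Truncation.

(** * Descent forces equality *)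

Section Decomposition.
Variables (R : realType) (m n : nat) (X0 D : 'M[R]_(m, n)).

(** [P] and [Q] project onto the column and row spaces of [X0]. Then [Dc = (1 - P) D (1 - Q)], and
    the rest [P D + (1 - P) D Q] has two terms of rank at most that of [X0]. Orthogonality is stated
    for every [T] killed by [P] and [Q], so that it applies to parts of [Dc]. *)
Lemma orthogonal_splitting :
  exists (P : 'M[R]_m) (Q : 'M[R]_n) (D0 Dc : 'M[R]_(m, n)),
  [/\ D = D0 + Dc, (\rank D0 <= 2 * \rank X0)%N,
      X0 *m Dc^T = 0 /\ X0^T *m Dc = 0, P *m Dc = 0 /\ Dc *m Q = 0 &
      forall T, P *m T = 0 -> T *m Q = 0 -> \tr (D0 *m T^T) = 0].
Proof.
have [P [pP PX _ rP]] := orth_proj_exists X0.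
have [Q [pQ QX _ rQ]] := orth_proj_exists X0^T.
pose Dc := (1%:M - P) *m D *m (1%:M - Q).
pose D0 := P *m D + (1%:M - P) *m D *m Q.
exists P, Q, D0, Dc; have [Psym PP] := pP; have [Qsym QQ] := pQ.
split.
- by rewrite /D0 /Dc mulmxBr mulmx1 -addrA subrKC -mulmxDl subrKC mul1mx.
- apply: leq_trans (mxrank_add _ _) _; rewrite mul2n -addnn leq_add //.
    exact: leq_trans (mxrankM_maxl _ _) rP.
  by rewrite -(mxrank_tr X0); exact: leq_trans (mxrankM_maxr _ _) rQ.
- split; rewrite /Dc.
    rewrite !trmx_mul [(1%:M - Q)^T](proj1 (orth_projC pQ)) !mulmxA.
    have -> : X0 *m (1%:M - Q) = 0.
      by rewrite mulmxBr mulmx1 -{2}[X0]trmxK -Qsym -trmx_mul QX trmxK subrr.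
    by rewrite !mul0mx.
  rewrite -(proj1 (orth_projC pP)) !mulmxA -trmx_mul.
  by rewrite mulmxBl mul1mx PX subrr trmx0 !mul0mx.
- split; rewrite /Dc.
    by rewrite !mulmxA [P *m (_ - _)]mulmxBr mulmx1 PP subrr !mul0mx.
  by rewrite -!mulmxA [(_ - Q) *m Q]mulmxBl mul1mx QQ subrr !mulmx0.
move=> T PT TQ.
have TtP : T^T *m P = 0 by rewrite -Psym -trmx_mul PT trmx0.
have QTt : Q *m T^T = 0 by rewrite -Qsym -trmx_mul TQ trmx0.
rewrite mulmxDl mxtraceD -[(1%:M - P) *m D *m Q *m T^T]mulmxA QTt mulmx0.
by rewrite mxtrace0 addr0 -mulmxA mxtrace_mulC -mulmxA TtP mulmx0 mxtrace0.
Qed.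

End Decomposition.

(** If [b > rho], the [k > N] values at least [b] would already exceed the bound, so [b <= rho]. The
    bound on [f] is then made linear by multiplying with [b] and using [b f(t) >= t f(b)] for
    [t <= b] and [b f(rho) <= rho f(b)]. *)
Lemma sum_tail_le (R : realType) (m : nat) (f : R -> R) (t : 'I_m -> R)
  (k N : nat) (B : {set 'I_m}) (b rho : R) :
  f 0 = 0 -> (forall x, 0 < x -> 0 < f x) -> increasing_concave f ->
  (forall i, 0 <= t i) -> #|B| = k -> (N < k)%N -> 0 <= b ->
  (forall i, i \in B -> b <= t i) -> (forall i, i \in ~: B -> t i <= b) ->
  0 <= rho -> \sum_i f (t i) <= N%:R * f rho ->
  k%:R * b + \sum_(i in ~: B) t i <= N%:R * rho.
Proof.
move=> f0 f_gt0 fc t0 Bk Nk b0 bB bC rho0 sumf.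
have fle := increasing_concave_le fc; have fge0 := increasing_concave_ge0 f0 fc.
have fsplit : k%:R * f b + \sum_(i in ~: B) f (t i) <= N%:R * f rho.
  apply: le_trans sumf; rewrite [leRHS](bigID (mem B)) /=.
  rewrite [X in _ <= _ + X](eq_bigl (fun i => i \in ~: B)) ?lerD2r; last first.
    by move=> i; rewrite inE.
  rewrite -Bk mulr_natl -sumr_const; apply: ler_sum => i iB.
  by rewrite fle ?bB.
have [b_eq0|b_neq0] := eqVneq b 0.
  rewrite b_eq0 mulr0 add0r big1 ?mulr_ge0 ?ler0n // => i iC.
  by apply/le_anti; rewrite t0 -b_eq0 bC.
have {b_neq0}b_gt0 : 0 < b by rewrite lt_neqAle eq_sym b_neq0.
have fb := f_gt0 _ b_gt0.
have brho : b <= rho.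
  rewrite leNgt; apply/negP => /ltW/(fle _ _ rho0) frho.
  have h1 : k%:R * f b <= N%:R * f b.
    apply: le_trans (ler_wpM2l (ler0n _ _) frho); apply: le_trans fsplit.
    by rewrite lerDl sumr_ge0 // => i _; rewrite fge0.
  by move: h1; rewrite ler_pM2r // ler_nat leqNgt Nk.
rewrite -(ler_pM2r fb); apply: (@le_trans _ _ (b * (N%:R * f rho))).
  apply: le_trans (ler_wpM2l b0 fsplit).
  rewrite mulrDl mulrDr lerD //; first by rewrite -mulrA mulrCA.
  rewrite mulr_suml mulr_sumr; apply: ler_sum => i iC.
  by have := increasing_concave_star f0 fc (t0 i) (bC i iC).
rewrite mulrCA -mulrA ler_wpM2l ?ler0n //.
by have := increasing_concave_star f0 fc b0 brho.
Qed.

Lemma TL_descent_eq (R : realType) (m n d : nat)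
    (A : {linear 'M[R]_(m, n) -> 'cV[R]_d}) (alpha epsilon : R)
    (X X0 : 'M[R]_(m, n)) (k N : nat) :
  (2 * \rank X0 <= N)%N ->
  0 <= alpha <= 1 / 2 -> 0 < epsilon -> (m <= n)%N -> (0 < N)%N -> (N < k)%N ->
  (N + k <= m)%N ->
  N%:R * Num.sqrt ((1 + ric A k) / k%:R) < Num.sqrt (1 - ric A (N + k)) ->
  A X = A X0 -> TL alpha epsilon X <= TL alpha epsilon X0 -> X = X0.
Proof.
move=> rX0 halpha heps mn N0 Nk Nkm cond AX TLX; set f := tl alpha epsilon.
have k0 : (0 < k)%N by exact: leq_ltn_trans Nk.
have m0 : (0 < m)%N by apply: leq_trans Nkm; rewrite addn_gt0 N0.
have n0 : (0 < n)%N by exact: leq_trans mn.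
have f0 : f 0 = 0 by exact: tl0.
have fc : increasing_concave f by exact: tl_increasing_concave.
have fge0 := increasing_concave_ge0 f0 fc.
have [P [Q [D0 [Dc [DE rD0 [X0Dc X0tDc] [PDc DcQ] orth]]]]] :=
  orthogonal_splitting X0 (X - X0).
have TLc : TL alpha epsilon Dc <= TL alpha epsilon D0.
  have XD : X - D0 = X0 + Dc.
    by apply/eqP; rewrite subr_eq -addrA [Dc + D0]addrC -DE subrKC.
  have := TL_subadd halpha heps X (- D0).
  rewrite XD TL_opp (TL_add_orthogonal _ _ X0Dc X0tDc) => TLsum.
  rewrite -(lerD2l (TL alpha epsilon X0)); apply: le_trans TLsum _.
  by rewrite lerD2r.
have [U [t [V sDc]]] := svd_exists Dc.
have [U0 [r [V0 sD0]]] := svd_exists D0.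
set rho := frobenius_norm D0.
have rho0 : 0 <= rho by exact: frobenius_norm_ge0.
(* At most [N] singular values of [D0] are nonzero, and each is at most the Frobenius norm. *)
have TL0 : TL alpha epsilon D0 <= N%:R * f rho.
  rewrite (svd_TL sD0) -/f.
  have -> : \sum_i f (r 0 i) = \sum_(i in [pred i | r 0 i != 0]) f (r 0 i).
    rewrite [RHS]big_mkcond; apply: eq_bigr => i _; rewrite inE.
    by have [->|] := eqVneq (r 0 i) 0.
  apply: (@le_trans _ _ (\sum_(i in [pred i | r 0 i != 0]) f rho)).
    apply: ler_sum => i _.
    apply: increasing_concave_le => //; first exact: svd_ge0 sD0 i.
    rewrite -(ler_pXn2r (n := 2)) ?nnegrE ?(svd_ge0 sD0) //.
    rewrite sqr_frobenius_norm (svd_mxtrace_gram sD0) (bigD1 i) //= lerDl.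
    by apply: sumr_ge0 => j _; rewrite sqr_ge0.
  rewrite sumr_const -(svd_rank sD0) -[_ *+ \rank _]mulr_natl ler_wpM2r ?fge0 //.
  by rewrite ler_nat (leq_trans rD0).
have sumt : \sum_i f (t 0 i) <= N%:R * f rho.
  by rewrite -(svd_TL sDc); exact: le_trans TL0.
(* If [rho = 0], then [sumt] has right-hand side 0, which forces every singular value of [Dc] to
   vanish. *)
suff /eqP rho_eq0 : rho == 0.
  have D00 : D0 = 0 by exact: frobenius_norm_eq0.
  have t0 i : t 0 i = 0.
    apply/eqP; rewrite eq_le (svd_ge0 sDc) andbT leNgt; apply/negP => ti.
    have := tl_gt0 alpha heps ti; rewrite ltNge => /negP; apply.
    move: sumt; rewrite rho_eq0 f0 mulr0; apply: le_trans.
    rewrite (bigD1 i) //= lerDl sumr_ge0 // => j _.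
    by rewrite fge0 // (svd_ge0 sDc).
  have Dc0 : Dc = 0.
    rewrite (svdE sDc); have -> : t = 0 by apply/rowP => i; rewrite t0 mxE.
    by rewrite linear0 mulmx0 mul0mx.
  by apply/eqP; rewrite -subr_eq0 DE D00 Dc0 addr0.
have kT : (k <= #|[set: 'I_m]%SET|)%N.
  by rewrite cardsT card_ord (leq_trans _ Nkm) // leq_addl.
have [B [b [_ Bk b0 bB bC]]] := largest_subset (svd_ge0 sDc) kT.
have {}bC i : i \in ~: B -> t 0 i <= b by rewrite -finset.setTD; exact: bC.
have tail : k%:R * b + \sum_(i in ~: B) t 0 i <= N%:R * rho.
  apply: (@sum_tail_le R m f (fun i => t 0 i) k N B b rho) => //.
  - by move=> x; exact: tl_gt0.
  - exact: svd_ge0 sDc.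
pose T := truncation U t V B; pose T' := truncation U t V (~: B).
have DcE : Dc = T + T'.
  rewrite -[LHS](truncationT sDc) (truncationD _ _ _ (finset.subsetT B)).
  by rewrite finset.setTD.
have AT : A (D0 + T) = - A T'.
  apply/eqP; rewrite -addr_eq0 -linearD -addrA -DcE -DE linearB /= AX subrr.
  exact: eqxx.
set F := frobenius_norm (D0 + T).
(* This is Pythagoras, as [D0] and [T] are orthogonal for the trace form. *)
have rhoF : rho <= F.
  rewrite -(ler_pXn2r (n := 2)) ?nnegrE ?frobenius_norm_ge0 // !sqr_frobenius_norm.
  have D0T : \tr (D0 *m T^T) = 0.
    by apply: orth; [apply: (mul_truncation sDc) | apply: (truncation_mul sDc)].
  have TD0 : \tr (T *m D0^T) = 0.
    by rewrite -mxtrace_tr trmx_mul trmxK.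
  rewrite [(D0 + T)^T]linearD /= mulmxDl !mulmxDr !mxtraceD D0T TD0 addr0 add0r.
  by rewrite lerDl mxtrace_gram_ge0.
have rank_le : (\rank (D0 + T)%R <= N + k)%N.
  apply: leq_trans (mxrank_add _ _) (leq_add (leq_trans rD0 rX0) _).
  by rewrite -Bk truncation_rank.
have Nk0 : (0 < N + k)%N by rewrite addn_gt0 N0.
have lower := ric_lower A Nk0 m0 n0 rank_le.
have upper := truncation_image_le sDc A k0 m0 n0 b0 bC.
rewrite eq_le rho0 andbT leNgt; apply/negP => rho_gt0.
have F_gt0 : 0 < F by exact: lt_le_trans rhoF.
have {}upper : euclidean_norm (A (D0 + T)) <=
    Num.sqrt ((1 + ric A k) / k%:R) * (N%:R * F).
  rewrite AT euclidean_normN; apply: le_trans upper _.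
  rewrite ler_wpM2l ?sqrtr_ge0 //; apply: le_trans tail _.
  by rewrite ler_wpM2l ?ler0n.
have := le_trans lower upper; rewrite mulrA ler_pM2r // mulrC leNgt.
by rewrite cond.
Qed.

Unset Implicit Arguments.
Set Strict Implicit.

(** The side conditions on [k] express that the displayed quantities are defined: the negative power
    of [2 * beta], the constant of order [2 * beta + k], and the square root of
    [1 - ric A (2 * beta + k)]. *)
Theorem theorem1 (R : realType) (m n d : nat) (hmn : (m <= n)%N)
    (A : {linear 'M[R]_(m, n) -> 'cV[R]_d}) (b : 'cV[R]_d)
    (alpha epsilon : R)
    (halpha : 0 <= alpha <= 1 / 2) (hepsilon : 0 < epsilon <= 1 / 3)
    (Xstar X0 : 'M[R]_(m, n))
    (hXstar : is_minimizer (TL alpha epsilon) [set X | A X = b] Xstar)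
    (hX0 : is_minimizer (fun X : 'M[R]_(m, n) => \rank X)
             [set X | A X = b] X0)
    (beta : nat) (hbeta : beta = \rank X0)
    (hcond : exists k : nat,
      [/\ (2 * beta < k)%N,
          (0 < beta)%N,
          (2 * beta + k <= m)%N,
          0 <= 1 - ric A (2 * beta + k)
        & epsilon `^ (1 - 2 * alpha) * ((2 * beta)%:R `^ (- (3 / 2)))
            * Num.sqrt (1 - ric A (2 * beta + k))
          - Num.sqrt ((1 + ric A k) / k%:R) > 0]) :
  (forall X : 'M[R]_(m, n),
     is_minimizer (TL alpha epsilon) [set X | A X = b] X -> X = Xstar) /\
  Xstar = X0.
Proof.
have [AX0 _] := hX0; have [k [Nk beta0 Nkm ric_le1 cond]] := hcond.
have [e0 e1] := andP hepsilon; have [al0 al1] := andP halpha.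
suff all_eq X : is_minimizer (TL alpha epsilon) [set X | A X = b] X -> X = X0.
  by split=> [X /all_eq -> |]; [rewrite (all_eq _ hXstar) | exact: all_eq].
move=> [AX Xmin]; rewrite hbeta in Nk beta0 Nkm ric_le1 cond.
have N0 : (0 < 2 * \rank X0)%N by rewrite muln_gt0.
have AXX0 : A X = A X0 by rewrite AX AX0.
apply: (TL_descent_eq (leqnn _) halpha e0 hmn N0 Nk Nkm _ AXX0 (Xmin X0 AX0)).
move: cond; rewrite subr_gt0.
set S := Num.sqrt (_ / _); set r := Num.sqrt _ => cond.
set N : R := (2 * \rank X0)%:R in cond *.
have N1 : 1 <= N by rewrite /N ler1n.
have NR0 : 0 < N by exact: lt_le_trans ltr01 N1.
(* As [epsilon <= 1] and [N >= 1], the factor in front of [r] is at most [N^-1], which turns the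
   condition into [N * S < r]. *)
have eps_le1 : epsilon `^ (1 - 2 * alpha) <= 1.
  rewrite -[leRHS](powRr0 epsilon); apply: ger_powR; last by lra.
  by rewrite e0 /=; lra.
have N_le : N `^ (- (3 / 2)) <= N^-1.
  by rewrite -(powR_inv1 (ltW NR0)); apply: ler_powR => //; lra.
rewrite mulrC -ltr_pdivlMr //; apply: lt_le_trans cond _.
rewrite mulrC; apply: ler_wpM2l; first exact: sqrtr_ge0.
rewrite -[N^-1]mul1r; apply: ler_pM => //; exact: powR_ge0.
Qed.
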